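(* Let $\alpha\in(0,1)$ and $c\ge 0$. Let $K$ satisfy: $K\in L^1(\mathbb R)$ is bounded and continuous, $K\ge 0$, $K(0)>0$, and $K(x)=K(-x)$ for all $x\in\mathbb R$. Define $\phi(z;c)=\int_0^{+\infty}g_\alpha(r)\,\mathcal K(z+cr)\,dr$ for $z\in\mathbb R$. Then the following hold. (i) Suppose there exist $\beta>1$ and $C_{alg}\ge0$ such that $\lim_{x\to+\infty}x^\beta K(x)=C_{alg}$. Then $$\lim_{z\to+\infty}z^{\beta-1}\phi(z;c)=\frac{C_{alg}}{\beta-1}.$$ (ii) Suppose there exist $\nu>0$ and $C_{exp}\ge0$ such that $\lim_{x\to+\infty}e^{\nu x}K(x)=C_{exp}$. Then $$\lim_{z\to+\infty}e^{\nu z}\phi(z;c)=\frac{C_{exp}}{\nu\{1+(\nu c)^\alpha\}}.$$ (iii) Suppose there exist $\sigma>0$, $p>1$ and $C_{sup}>0$ such that $\lim_{x\to+\infty}e^{\sigma x^p}K(x)=C_{sup}$. Then $$\lim_{z\to+\infty}z^{p-1}e^{\sigma z^p}\phi(z;0)=\frac{C_{sup}}{\sigma p}\quad\text{when } c=0,$$ and $$\lim_{z\to+\infty}z^{(1+\alpha)(p-1)}e^{\sigma z^p}\phi(z;c)=\frac{C_{sup}}{(\sigma p)^{1+\alpha}c^\alpha}\quad\text{when } c>0.$$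
   Context: Notation: $\mathcal K(x)=\int_x^{+\infty}K(y)\,dy$; $E_{\alpha,\beta}(z)=\sum_{n=0}^\infty \frac{z^n}{\Gamma(\alpha n+\beta)}$ is the Mittag-Leffler function; $g_\alpha(t)=t^{\alpha-1}E_{\alpha,\alpha}(-t^\alpha)$ for $t>0$. *)

(* Defs.v *)
(* Over an abstract realType, with MathComp-Analysis. *)
From HB Require Import structures.
From mathcomp Require Import all_boot all_order all_algebra.
From mathcomp Require Import all_classical all_reals all_analysis.

Set Implicit Arguments.
Unset Strict Implicit.
Unset Printing Implicit Defensive.

Import Order.TTheory GRing.Theory Num.Theory.
Import numFieldNormedType.Exports.

Local Open Scope classical_set_scope.
Local Open Scope ring_scope.

(* The integral converges for s > 0, the only range used below. *)
Definition Gamma {R : realType} (s : R) : R :=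
  \int[lebesgue_measure]_(t in `]0, +oo[) (t `^ (s - 1) * expR (- t)).

(* Restricted to a real argument z. *)
Definition mittag_leffler {R : realType} (alpha beta z : R) : R :=
  limn (series (fun n : nat => z ^+ n / Gamma (alpha * n%:R + beta))).

Definition g {R : realType} (alpha t : R) : R :=
  t `^ (alpha - 1) * mittag_leffler alpha alpha (- (t `^ alpha)).

Definition calK {R : realType} (K : R -> R) (x : R) : R :=
  \int[lebesgue_measure]_(y in `[x, +oo[) K y.

(* Since g is specified for positive arguments only, the integration domain
   leaves out the null set {0}. *)
Definition phi {R : realType} (K : R -> R) (alpha z c : R) : R :=
  \int[lebesgue_measure]_(r in `]0, +oo[) (g alpha r * calK K (z + c * r)).

(* Main.v *)
Require Import Defs.
From HB Require Import structures.
From mathcomp Require Import all_boot all_order all_algebra.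
From mathcomp Require Import all_classical all_reals all_analysis.
From mathcomp Require Import measurable_realfun ring lra.

Set Implicit Arguments.
Unset Strict Implicit.
Unset Printing Implicit Defensive.

Import Order.TTheory GRing.Theory Num.Theory.
Import numFieldNormedType.Exports.

Local Open Scope classical_set_scope.
Local Open Scope ring_scope.

(** Everything rests on three facts about [g al]: it is positive on the
    positive half-line, it lies below the Riemann-Liouville kernel
    [k t = t^(al-1) / Gamma al], and its Laplace transform at every [l >= 0]
    is [1 / (1 + l^al)].  In particular its total mass, at [l = 0], is [1].

    These facts are obtained without complex analysis.  Beta integrals give
    that the kernels [rlker a] form a convolution semigroup ([conv_rlker]), so
    the alternating Mittag-Leffler series can be convolved term by term with
    [k], and [g] solves the Volterra equation [g + k * g = k] ([volterra_gplus]).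
    Since [k] is log-convex, its resolvent [g] stays positive ([g_gt0]): at a
    first zero [T] of [g], log-convexity bounds [g u] for [u] slightly before
    [T] by the integral of [k (T - s) g s] over [s] in [u, T], which is a small
    multiple of the maximum of [g] on a short interval ending at [T]; taking
    [u] to be the maximum point is absurd.  Positivity turns the Volterra
    equation into [0 <= g <= k], and Tonelli's theorem turns it into
    [L + l^(-al) L = l^(-al)] for the Laplace transform [L] of [g]; the value
    at [l = 0] is a monotone limit ([laplace_g_gt0], [laplace_g0]).

    The tail of [calK K] follows from that of [K] by comparing [K] with the
    derivative of an explicit primitive ([calK_asymptotics]).

    In the algebraic and exponential regimes, and in the superexponential one
    with [c = 0], the normalised tail of [calK K] at [z + c r] converges to
    [M e^(- l r)], with [l = nu c] in the exponential case and [l = 0] in the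
    others, and it is at most its value at [z].  Dominated convergence against
    the integrable function [g] then gives [M / (1 + l^al)] ([phi_limit_exp]).

    In the superexponential regime with [c > 0], [calK K] varies on the scale
    [z^(1-p)].  With [r = z^(1-p) s], the rescaled [g] converges to [k s], and
    the rescaled tail to [C / (sigma p) e^(- sigma p c s)].  The bound [g <= k]
    and the convexity of [z^p] provide the domination, and the limit is the
    Laplace transform of [k] at [sigma p c] ([phi_tail_superexp]). *)

(** * Affine substitutions, convolutions and Laplace transforms *)

Notation leb := (@lebesgue_measure _).

(** Both measures, Lebesgue measure and [a] times its image under the affine
    map, agree on half-open intervals, hence on all Borel sets. *)
Lemma integral_affine (R : realType) (a b : R) (F : R -> \bar R) :
  0 < a -> measurable_fun setT F -> (forall x, 0 <= F x)%E ->
  (a%:E * \int[leb]_x F (a * x + b)%R = \int[leb]_x F x)%E.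
Proof.
move=> a0 mF F0.
pose h (x : measurableTypeR R) : measurableTypeR R := a * x + b.
have mh : measurable_fun setT h.
  by apply: measurable_funD => //; exact: measurable_funM.
(* The measurability of [h] is an explicit argument of this structure. *)
pose ph := measure_function_pushforward__canonical__measure_function_Measure leb mh.
pose nu : {measure set (measurableTypeR R) -> \bar R} := mscale (NngNum (ltW a0)) ph.
have E A : measurable A -> leb A = nu A.
  apply: lebesgue_measure_unique.
  move=> X /ocitvP[->|[[l r] /= lr ->]]; first by rewrite !measure0.
  rewrite /nu /= /mscale /= /pushforward.
  rewrite [h @^-1` _](_ : _ = `](l - b) / a, (r - b) / a]%classic); last first.
    apply/seteqP; split => x /=; rewrite !in_itv /= /h ltr_pdivrMr // ler_pdivlMr //;
      by rewrite ltrBlDr lerBrDr mulrC.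
  rewrite !lebesgue_measure_itv /= !lte_fin lr ltr_pM2r ?invr_gt0 // ltrD2r lr.
  rewrite -!EFinD -EFinM; congr EFin; field; exact: lt0r_neq0.
rewrite [RHS](@eq_measure_integral _ _ _ _ nu); last by move=> A mA _; exact: E.
rewrite ge0_integral_mscale //= ge0_integral_pushforward //.
Qed.

(** Functions on the half-line are extended by zero to the whole line, so that
    this integral over the line is the Volterra convolution over [0, t].
    Extended values are used so that Tonelli's theorem applies throughout. *)
Definition conv (R : realType) (f h : R -> \bar R) (t : R) : \bar R :=
  (\int[leb]_s (f (t - s)%R * h s))%E.

(** The two-sided transform; it is the usual one for functions that vanish on
    the negative half-line. *)
Definition laplace (R : realType) (f : R -> \bar R) (l : R) : \bar R :=
  (\int[leb]_t ((expR (- (l * t)))%:E * f t))%E.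

Lemma measurable_fun_sub (R : realType) (f : R -> \bar R) :
  measurable_fun setT f ->
  measurable_fun setT (fun p : R * R => f (p.1 - p.2)).
Proof.
move=> mf; apply: (measurableT_comp mf).
by apply: measurable_funB; [exact: measurable_fst|exact: measurable_snd].
Qed.

(** Tonelli's theorem, after splitting [e^(-l t)] as
    [e^(-l s) e^(-l (t-s))]. *)
Lemma laplace_conv (R : realType) (f h : R -> \bar R) (l : R) :
  measurable_fun setT f -> (forall x, 0 <= f x)%E ->
  measurable_fun setT h -> (forall x, 0 <= h x)%E ->
  laplace (conv f h) l = (laplace f l * laplace h l)%E.
Proof.
move=> mf f0 mh h0; rewrite /laplace /conv.
have mexp : measurable_fun setT (fun t : R => (expR (- (l * t)))%:E).
  apply/measurable_EFinP; apply: measurableT_comp => //.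
  by apply: measurable_funN; apply: measurable_funM.
have mfh : measurable_fun setT (fun p : R * R =>
    ((expR (- (l * p.1)))%:E * (f (p.1 - p.2)%R * h p.2))%E).
  apply: emeasurable_funM.
    by apply: (measurableT_comp mexp); exact: measurable_fst.
  apply: emeasurable_funM.
    exact: measurable_fun_sub.
  by apply: (measurableT_comp mh); exact: measurable_snd.
have mfs t : measurable_fun setT (fun s : R => f (t - s)).
  apply: (measurableT_comp mf); exact: measurable_funB.
transitivity (\int[leb]_t \int[leb]_s
    ((expR (- (l * t)))%:E * (f (t - s)%R * h s)))%E.
  apply: eq_integral => t _; rewrite ge0_integralZl //.
    by apply: emeasurable_funM => //; exact: mfs.
  by move=> s _; exact: mule_ge0.
have p0 p : (0 <= (expR (- (l * p.1)))%:E * (f (p.1 - p.2)%R * h p.2))%E.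
  by rewrite mule_ge0 ?lee_fin ?expR_ge0 // mule_ge0.
have /= -> := @fubini_tonelli _ _ (measurableTypeR R) (measurableTypeR R) R leb leb _ mfh p0.
rewrite -ge0_integralZl //=; last first.
- apply: integral_ge0 => t _; by rewrite mule_ge0 // lee_fin expR_ge0.
- move=> s _; by rewrite mule_ge0 // lee_fin expR_ge0.
- exact: emeasurable_funM.
apply: eq_integral => s _.
transitivity (\int[leb]_t (((expR (- (l * s)))%:E * h s) *
    ((expR (- (l * (t - s))))%:E * f (t - s)%R)))%E.
  apply: eq_integral => t _.
  have -> : expR (- (l * t)) = expR (- (l * s)) * expR (- (l * (t - s))).
    by rewrite -expRD; congr expR; ring.
  rewrite EFinM -!muleA; congr (_ * _)%E.
  by rewrite muleA muleC.
rewrite ge0_integralZl //=; last first.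
- by rewrite mule_ge0 // lee_fin expR_ge0.
- move=> t _; by rewrite mule_ge0 // lee_fin expR_ge0.
- apply: emeasurable_funM => //.
    apply: (measurableT_comp mexp); exact: measurable_funB.
  by apply: (measurableT_comp mf); exact: measurable_funB.
rewrite [RHS]muleC; congr (_ * _)%E.
have := @integral_affine R 1 (- s) (fun t : R => (expR (- (l * t)))%:E * f t)%E ltr01.
rewrite mul1e => <-.
- by apply: eq_integral => t _; rewrite mul1r.
- exact: emeasurable_funM.
- by move=> x; rewrite mule_ge0 // lee_fin expR_ge0.
Qed.

(** * Power tails and the Gamma function *)

Lemma cvgry_powR (R : realType) (a : R) : 0 < a -> x `^ a @[x --> +oo%R] --> +oo%R.
Proof.
move=> a0; apply/cvgryPge => A; near=> x.
have x1 : 1 <= x by near: x; exact: nbhs_pinfty_ge.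
pose B := Num.max 1 A.
have B0 : 0 < B by rewrite lt_max ltr01.
rewrite (@le_trans _ _ B) //; first by rewrite le_max lexx orbT.
have -> : B = (B `^ a^-1) `^ a by rewrite -powRrM mulVf ?gt_eqF // powRr1 // ltW.
apply: ge0_ler_powR.
- exact: ltW.
- by rewrite nnegrE powR_ge0.
- by rewrite nnegrE (le_trans ler01 x1).
- by near: x; apply: nbhs_pinfty_ge; exact: num_real.
Unshelve. all: by end_near. Qed.

Lemma cvgr_powRN (R : realType) (a : R) : 0 < a -> x `^ (- a) @[x --> +oo%R] --> (0 : R).
Proof.
move=> a0; under eq_cvg do rewrite powRN.
apply/gtr0_cvgV0; last exact: cvgry_powR.
near=> x; rewrite powR_gt0 //; near: x; exact: nbhs_pinfty_gt.
Unshelve. end_near. Qed.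

(** This evaluates the tail integrals of all the comparison functions below,
    and the integral that dominates the Gamma integral. *)
Lemma integral_tail_primitive (R : realType) (h H : R -> R) (a z : R) : a < z ->
  (forall x, a < x -> is_derive x 1 H (- h x)) ->
  (forall x, a < x -> 0 <= h x) ->
  (forall x, a < x -> {for x, continuous h}) ->
  H x @[x --> +oo%R] --> (0 : R) ->
  (\int[leb]_(x in `[z, +oo[) (h x)%:E = (H z)%:E)%E.
Proof.
move=> az dH h0 ch H0.
have dNH x : a < x -> is_derive x 1 (fun x => - H x) (h x).
  by move=> ax; have := dH x ax => ?; rewrite -[h x]opprK; exact: is_deriveN.
have -> : (H z)%:E = (0%:E - (- H z)%:E)%E by rewrite sub0e EFinN oppeK.
apply: (@ge0_continuous_FTC2y _ _ (fun x => - H x)).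
- by move=> x zx; apply: h0; exact: lt_le_trans zx.
- apply/continuous_within_itvcyP; split.
    by move=> x; rewrite in_itv /= andbT => zx; apply: ch; exact: lt_trans zx.
  by apply: cvg_at_right_filter; exact: ch.
- by rewrite -[0]oppr0; exact: cvgN.
- by move=> x zx; apply: ex_derive; apply: dNH; exact: lt_trans zx.
- apply: cvg_at_right_filter.
  have : {for z, continuous (fun x => - H x)}; last by [].
  apply: differentiable_continuous; apply/derivable1_diffP.
  by case: (dNH z az).
- move=> x; rewrite in_itv /= andbT => zx; rewrite derive1E.
  by have /@derive_val -> := dNH x (lt_trans az zx).
Qed.

Lemma continuous_powR (R : realType) (a x : R) : 0 < x ->
  {for x, continuous (fun y : R => y `^ a)}.
Proof.
move=> x0; apply: differentiable_continuous; apply/derivable1_diffP.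
by apply: ex_derive; exact: is_derive1_powR.
Qed.

(** The integrand is at most a constant times the derivative of
    [- 1 / (1 + t^a)], a function whose total variation is [1]; a single
    domination handles both the singularity at [0] and the decay at infinity. *)
Lemma gamma_integral_lty (R : realType) (a : R) : 0 < a ->
  (\int[leb]_(t in `]0%R, +oo[) (t `^ (a - 1) * expR (- t))%:E < +oo)%E.
Proof.
move=> a0.
(* [h] is minus the derivative of [H]. *)
pose h (t : R) := a * t `^ (a - 1) / (1 + t `^ a) ^+ 2.
pose H (t : R) := (1 + t `^ a)^-1.
have D0 (t : R) : 0 < 1 + t `^ a by rewrite ltr_pwDl // powR_ge0.
have hE z : 0 < z -> (\int[leb]_(x in `[z, +oo[) (h x)%:E = (H z)%:E)%E.
  move=> z0; apply: (@integral_tail_primitive _ _ _ 0 z) => //.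
  - move=> x x0; have dp := is_derive1_powR a x0.
    have -> : - h x = - (1 + x `^ a) ^- 2 *: (0 + a * x `^ (a - 1)).
      by rewrite /h add0r /GRing.scale /= mulNr mulrC.
    by apply: is_deriveV; rewrite gt_eqF.
  - by move=> x x0; rewrite /h divr_ge0 ?sqr_ge0 // mulr_ge0 ?powR_ge0 // ltW.
  - move=> x x0; apply: cvgM.
      by apply: cvgM; [exact: cvg_cst|exact: continuous_powR].
    apply: cvgV; first by rewrite sqrf_eq0 gt_eqF.
    by apply: (@cvgM _ _ _ _ (fun t => 1 + t `^ a) (fun t => 1 + t `^ a));
      apply: cvgD; [exact: cvg_cst|exact: continuous_powR|exact: cvg_cst|exact: continuous_powR].
  - apply/gtr0_cvgV0; first by apply: nearW => x; exact: D0.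
    apply/cvgryPge => A; near=> x; rewrite (@le_trans _ _ (x `^ a)) ?lerDr //.
    by near: x; have /cvgryPge := cvgry_powR a0; apply.
have [C C0 hC] : exists2 C : R, 0 <= C & forall t : R, 0 < t ->
    t `^ (a - 1) * expR (- t) <= C * h t.
  have [n an] : exists n, a <= n.+1%:R.
    exists (Num.bound a); apply: ltW; apply: (lt_trans (archi_boundP (ltW a0))).
    by rewrite ltr_nat.
  (* Chosen so that [1 + t^a <= M e^(t/2)], from [x^(n+1) <= (n+1)! e^x] at
     [x = t / 2]. *)
  pose M : R := 2 + 2 ^+ n.+1 * (n.+1)`!%:R.
  have M0 : 0 <= M by rewrite addr_ge0 // mulr_ge0 // exprn_ge0.
  exists (M ^+ 2 / a) => [|t t0]; first by rewrite divr_ge0 ?sqr_ge0 // ltW.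
  have key : 1 + t `^ a <= M * expR (t / 2).
    have e1 : 1 <= expR (t / 2) by rewrite -expR0 ler_expR divr_ge0 // ltW.
    have ta : t `^ a <= 1 + t ^+ n.+1.
      have [t1|t1] := leP t 1.
        rewrite (@le_trans _ _ 1) // ?lerDl ?exprn_ge0 // ?(ltW t0) //.
        have := ge0_ler_powR (ltW a0); move=> /(_ t 1); rewrite powR1 !nnegrE; apply=> //.
        exact: ltW.
      rewrite (@le_trans _ _ (t ^+ n.+1)) // ?lerDr // -powR_mulrn ?ler_powR //; exact: ltW.
    have te : t ^+ n.+1 <= 2 ^+ n.+1 * (n.+1)`!%:R * expR (t / 2).
      have t20 : 0 <= t / 2 by rewrite divr_ge0 // ltW.
      have /(le_trans _) H1 := expR_ge1Dxn n t20.
      have : (t / 2) ^+ n.+1 / n.+1`!%:R <= expR (t / 2) by apply: H1; rewrite lerDr.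
      rewrite ler_pdivrMr ?ltr0n ?fact_gt0 // exprMn exprVn ler_pdivrMr ?exprn_gt0 //.
      by move=> /le_trans; apply; rewrite le_eqVlt; apply/orP; left; apply/eqP; ring.
    rewrite /M mulrDl; nra.
  have -> : M ^+ 2 / a * h t = t `^ (a - 1) * (M ^+ 2 / (1 + t `^ a) ^+ 2).
    by rewrite /h; field; rewrite !gt_eqF.
  rewrite ler_wpM2l ?powR_ge0 // ler_pdivlMr ?exprn_gt0 //.
  rewrite expRN ler_pdivrMl ?expR_gt0 //.
  have -> : expR t = expR (t / 2) ^+ 2 by rewrite -expRM_natr; congr expR; field.
  by rewrite mulrC -exprMn ler_sqr ?nnegrE ?mulr_ge0 ?expR_ge0 // ltW.
have mh : measurable_fun setT h.
  apply: measurable_funM.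
    by apply: measurable_funM => //; exact: measurable_powR.
  have -> : (fun x : R => (1 + x `^ a) ^- 2) = (fun x => (1 + x `^ a) `^ (- 2)).
    by apply/funext => x; rewrite powRN -powR_mulrn // ltW.
  apply: (@measurableT_comp _ _ _ _ _ _ (@powR R ^~ (-2))).
    exact: measurable_powR.
  by apply: measurable_funD => //; exact: measurable_powR.
pose F n : set (measurableTypeR R) := `[(n.+1%:R^-1 : R), +oo[%classic.
have FU : \bigcup_n F n = `]0, +oo[%classic.
  apply/seteqP; split => x /=.
    by move=> [n _]; rewrite /F /= !in_itv /= !andbT; apply: lt_le_trans.
  rewrite in_itv /= andbT => x0; exists (Num.bound x^-1) => //.
  rewrite /F /= in_itv /= andbT invf_ple ?posrE // ltW //.
  by rewrite (lt_trans (archi_boundP _)) ?invr_ge0 ?ltr_nat // ltW.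
have hfin : (\int[leb]_(x in `]0%R, +oo[) (h x)%:E <= 1)%E.
  rewrite -FU.
  have h0 x : 0 < x -> (0 <= (h x)%:E)%E.
    by move=> x0; rewrite lee_fin /h divr_ge0 ?sqr_ge0 // mulr_ge0 ?powR_ge0 // ltW.
  have cv : (\int[leb]_(x in F n) (h x)%:E @[n --> \oo] -->
      \int[leb]_(x in \bigcup_n F n) (h x)%:E)%E.
    apply: ge0_nondecreasing_set_cvg_integral.
    - apply/nondecreasing_seqP => n; apply/subsetPset => x; rewrite /F /= !in_itv /= !andbT.
      by apply: le_trans; rewrite lef_pV2 ?posrE // ler_nat.
    - by move=> n; exact: measurable_itv.
    - by move=> n; apply/measurable_EFinP; exact: measurable_funTS.
    - move=> n x; rewrite /F /= in_itv /= andbT => nx; apply: h0.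
      exact: lt_le_trans nx.
  apply: (cvge_to_le cv); apply: nearW => n.
  rewrite hE // lee_fin /H invf_le1 // lerDl; exact: powR_ge0.
apply: (@le_lt_trans _ _ (C%:E * \int[leb]_(x in `]0%R, +oo[) (h x)%:E)%E).
  rewrite -ge0_integralZl //=.
  - apply: ge0_le_integral => //=.
    + by move=> x _; rewrite lee_fin mulr_ge0 ?powR_ge0 ?expR_ge0.
    + apply/measurable_EFinP/measurable_funTS; apply: measurable_funM.
        exact: measurable_powR.
      by apply: measurableT_comp => //; exact: oppr_measurable.
    + by apply/measurable_EFinP/measurable_funTS; apply: measurable_funM.
    + by move=> x; rewrite /= in_itv /= andbT lee_fin => x0; exact: hC.
  - by apply/measurable_EFinP; exact: measurable_funTS.
  - move=> x; rewrite /= in_itv /= andbT => x0.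
    by rewrite lee_fin /h divr_ge0 ?sqr_ge0 // mulr_ge0 ?powR_ge0 // ltW.
apply: (@le_lt_trans _ _ (C%:E * 1)%E); first by apply: lee_wpmul2l.
by rewrite mule1 ltry.
Unshelve. all: by end_near. Qed.

(** The Riemann-Liouville kernel of fractional integration of order [a],
    extended by zero. *)
Definition rlker (R : realType) (a t : R) : R :=
  if 0 < t then t `^ (a - 1) / Gamma a else 0.

Lemma Gamma_integral (R : realType) (a : R) : 0 < a ->
  (\int[leb]_(t in `]0%R, +oo[) (t `^ (a - 1) * expR (- t))%:E = (Gamma a)%:E)%E.
Proof.
move=> a0; rewrite /Gamma /Rintegral fineK // ge0_fin_numE ?gamma_integral_lty //.
by apply: integral_ge0 => t _; rewrite lee_fin mulr_ge0 ?powR_ge0 ?expR_ge0.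
Qed.

Lemma measurable_gamma_fun (R : realType) (a : R) (D : set R) :
  measurable_fun D (fun t : R => t `^ (a - 1) * expR (- t)).
Proof.
apply: measurable_funTS; apply: measurable_funM; first exact: measurable_powR.
by apply: measurableT_comp => //; exact: oppr_measurable.
Qed.

(** Only the part of the Gamma integral over [M, M+1] is kept.  As [M] is
    arbitrary, [Gamma] grows faster than any geometric sequence along
    arithmetic progressions, which is all that the series need. *)
Lemma Gamma_lower_bound (R : realType) (s M : R) : 1 <= s -> 0 < M ->
  M `^ (s - 1) * expR (- (M + 1)) <= Gamma s.
Proof.
move=> s1 M0; have s0 : 0 < s by rewrite (lt_le_trans ltr01).
rewrite -lee_fin -Gamma_integral //.
pose c : R := M `^ (s - 1) * expR (- (M + 1)).
have -> : c%:E = (\int[leb]_(t in `[M, (M + 1)%R]) c%:E)%E.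
  rewrite integral_cst //= lebesgue_measure_itv /= lte_fin ltrDl ltr01.
  by rewrite -EFinD -EFinM addrC addKr mulr1.
apply: (@le_trans _ _ (\int[leb]_(t in `[M, (M + 1)%R]) (t `^ (s - 1) * expR (- t))%:E)%E).
  apply: ge0_le_integral => //=.
  - by move=> x _; rewrite lee_fin mulr_ge0 ?powR_ge0 ?expR_ge0.
  - by apply/measurable_EFinP; exact: measurable_gamma_fun.
  - move=> x; rewrite /= in_itv /= => /andP[Mx xM].
    rewrite lee_fin ler_pM ?powR_ge0 ?expR_ge0 //.
      apply: ge0_ler_powR; rewrite ?subr_ge0 // nnegrE; first exact: ltW.
      by rewrite (le_trans (ltW M0)).
    by rewrite ler_expR lerN2.
apply: ge0_subset_integral => //=.
- by apply/measurable_EFinP; exact: measurable_gamma_fun.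
- by move=> x _; rewrite lee_fin mulr_ge0 ?powR_ge0 ?expR_ge0.
- by move=> x; rewrite /= !in_itv /= andbT => /andP[+ _]; exact: lt_le_trans.
Qed.

Lemma Gamma_gt0 (R : realType) (a : R) : 0 < a -> 0 < Gamma a.
Proof.
move=> a0.
rewrite -lte_fin -Gamma_integral //.
pose c : R := Num.min 1 (2 `^ (a - 1)) * expR (- 2).
have c0 : 0 < c by rewrite mulr_gt0 ?expR_gt0 // lt_min ltr01 powR_gt0.
apply: (@lt_le_trans _ _ (\int[leb]_(t in `[1%R, 2%R]) c%:E)%E).
  rewrite integral_cst //= lebesgue_measure_itv /= lte_fin ltr1n.
  by rewrite -EFinD -EFinM lte_fin mulr_gt0 // subr_gt0 ltr1n.
apply: (@le_trans _ _ (\int[leb]_(t in `[1%R, 2%R]) (t `^ (a - 1) * expR (- t))%:E)%E).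
  apply: ge0_le_integral => //=.
  - by move=> x _; rewrite lee_fin mulr_ge0 ?powR_ge0 ?expR_ge0.
  - by apply/measurable_EFinP; exact: measurable_gamma_fun.
  - move=> x; rewrite /= in_itv /= => /andP[x1 x2].
    rewrite lee_fin ler_pM ?expR_ge0 //; last by rewrite ler_expR lerN2.

    rewrite ge_min; have [a1|a1] := leP 1 a; apply/orP; [left|right].
      by rewrite -[leLHS](powRr0 x) ler_powR // subr_ge0.
    rewrite -[a - 1]opprB !powRN.
    rewrite lef_pV2 ?posrE ?powR_gt0 ?(lt_le_trans ltr01 x1) //.
    by apply: ge0_ler_powR; rewrite ?subr_ge0 ?nnegrE ?(le_trans ler01 x1) // ltW.
apply: ge0_subset_integral => //=.
- by apply/measurable_EFinP; exact: measurable_gamma_fun.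
- by move=> x _; rewrite lee_fin mulr_ge0 ?powR_ge0 ?expR_ge0.
- by move=> x; rewrite /= !in_itv /= andbT => /andP[+ _]; exact: lt_le_trans.
Qed.

Lemma rlker_ge0 (R : realType) (a t : R) : 0 < a -> 0 <= rlker a t.
Proof.
move=> a0; rewrite /rlker; case: ifP => // t0.
by rewrite divr_ge0 ?powR_ge0 // ltW // Gamma_gt0.
Qed.

Lemma measurable_rlker (R : realType) (a : R) : measurable_fun setT (@rlker R a).
Proof.
apply: measurable_fun_ifT.
- by apply: measurable_fun_ltr.
- by apply: measurable_funM => //; exact: measurable_powR.
- exact: measurable_cst.
Qed.

Lemma rlkerZ (R : realType) (a l t : R) : 0 < l -> rlker a (l * t) = l `^ (a - 1) * rlker a t.
Proof.
move=> l0; rewrite /rlker pmulr_rgt0 //; case: ifP => t0; last by rewrite mulr0.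
by rewrite powRM ?mulrA // ltW.
Qed.

Lemma integral_vanish_neg (R : realType) (f : R -> \bar R) : (forall t : R, t <= 0 -> f t = 0%E) ->
  (\int[leb]_t f t = \int[leb]_(t in `]0%R, +oo[) f t)%E.
Proof.
move=> f0; rewrite [RHS]integral_mkcond; apply: eq_integral => t _.
rewrite patchE; case: ifPn => // ; rewrite notin_setE /= in_itv /= andbT => /negP.
by rewrite -leNgt => /f0.
Qed.

Lemma laplace_rlker1 (R : realType) (a : R) : 0 < a ->
  laplace (EFin \o rlker a) 1 = 1%E.
Proof.
move=> a0; rewrite /laplace integral_vanish_neg; last first.
  by move=> t t0; rewrite /rlker /= ltNge t0 mule0.
transitivity (\int[leb]_(t in `]0%R, +oo[) ((Gamma a)^-1%:E * (t `^ (a - 1) * expR (- t))%:E))%E.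
  apply: eq_integral => t; rewrite inE /= in_itv /= andbT => t0.
  by rewrite /rlker t0 mul1r -!EFinM; congr EFin; ring.
have G0 := Gamma_gt0 a0.
rewrite ge0_integralZl //=.
- by rewrite Gamma_integral // -EFinM mulVf // gt_eqF.
- by apply/measurable_EFinP; exact: measurable_gamma_fun.
- by move=> x _; rewrite lee_fin mulr_ge0 ?powR_ge0 ?expR_ge0.
- by rewrite lee_fin invr_ge0 ltW.
Qed.

Lemma measurable_expZ (R : realType) (l : R) :
  measurable_fun setT (fun t : R => (expR (- (l * t)))%:E).
Proof.
apply/measurable_EFinP; apply: measurableT_comp => //.
by apply: measurable_funN; apply: measurable_funM.
Qed.

(** Substituting [l t] for [t] reduces the claim to [l = 1], where it is the
    definition of [Gamma]. *)
Lemma laplace_rlker (R : realType) (a l : R) : 0 < a -> 0 < l ->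
  laplace (EFin \o rlker a) l = (l `^ (- a))%:E.
Proof.
move=> a0 l0.
have := laplace_rlker1 a0; rewrite /laplace => E1.
have := @integral_affine R l 0 (fun t : R => (expR (- (1 * t)))%:E * (rlker a t)%:E)%E l0.
rewrite E1 => E2.
have {E2} : (l%:E * \int[leb]_x ((l `^ (a - 1))%:E * ((expR (- (l * x)))%:E * (rlker a x)%:E)) = 1)%E.
  rewrite -E2; last 2 first.
  - apply: emeasurable_funM; first exact: measurable_expZ.
    by apply/measurable_EFinP; exact: measurable_rlker.
  - by move=> x; rewrite mule_ge0 // lee_fin ?expR_ge0 ?rlker_ge0.
  congr (_ * _)%E; apply: eq_integral => x _.
  by rewrite addr0 rlkerZ // mul1r EFinM muleCA.
rewrite ge0_integralZl //=; last 3 first.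
- apply: emeasurable_funM; first exact: measurable_expZ.
  by apply/measurable_EFinP; exact: measurable_rlker.
- by move=> x _; rewrite mule_ge0 // lee_fin ?expR_ge0 ?rlker_ge0.
- by rewrite lee_fin powR_ge0.
rewrite muleA -EFinM mulr_powRB1 ?ltW //.
set I := (\int[_]_x _)%E => E; rewrite powRN.
have la : l `^ a != 0 by rewrite gt_eqF ?powR_gt0.
rewrite -[LHS]mul1e -[1%E in LHS](_ : ((l `^ a)^-1%:E * (l `^ a)%:E)%E = 1%E).
  by rewrite -muleA E mule1.
by rewrite -EFinM mulVf.
Qed.

(** The Beta integral in semigroup form.  By scaling, the convolution is a
    constant [B] times [rlker (a + b)]; comparing Laplace transforms at [1]
    identifies [B]. *)
Lemma conv_rlker (R : realType) (a b t : R) : 0 < a -> 0 < b ->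
  conv (EFin \o rlker a) (EFin \o rlker b) t = (rlker (a + b) t)%:E.
Proof.
move=> a0 b0; have ab0 : 0 < a + b by rewrite addr_gt0.
have mf c : measurable_fun setT (EFin \o @rlker R c).
  by apply/measurable_EFinP; exact: measurable_rlker.
have fge c x : 0 < c -> (0 <= (EFin \o @rlker R c) x)%E.
  by move=> c0; rewrite lee_fin rlker_ge0.
pose B := conv (EFin \o rlker a) (EFin \o rlker b) (1 : R).
have B0 : (0 <= B)%E.
  by apply: integral_ge0 => x _; rewrite mule_ge0 // fge.
have scale s : conv (EFin \o rlker a) (EFin \o rlker b) s =
    ((Gamma (a + b) * rlker (a + b) s)%:E * B)%E.
  have [s0|s0] := leP s 0.
    rewrite [rlker _ s]/rlker ltNge s0 /= mulr0 mul0e /conv.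
    apply: integral0_eq => x _ /=.
    rewrite /rlker; case: ifP => [sx|]; last by rewrite mul0e.
    by rewrite ifF ?mule0 //; apply/negbTE; rewrite -leNgt; move: sx; rewrite subr_gt0; lra.
  rewrite /conv.
  rewrite -(@integral_affine R s 0 (fun x => (EFin \o rlker a) (s - x)%R * (EFin \o rlker b) x)%E s0).
  - have -> : Gamma (a + b) * rlker (a + b) s = s * (s `^ (a - 1) * s `^ (b - 1)).
      rewrite /rlker s0 mulrCA divff ?mulr1 ?gt_eqF ?Gamma_gt0 //.
      rewrite -powRD; last by rewrite (gt_eqF s0) implybT.
      rewrite -[X in X * _](powRr1 (ltW s0)) -powRD; last by rewrite (gt_eqF s0) implybT.
      by congr (_ `^ _); ring.
    rewrite EFinM -muleA; congr (_ * _)%E.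
    rewrite -ge0_integralZl //=.
    + apply: eq_integral => x _.
      rewrite addr0 -[X in X - _](mulr1 s) -mulrBr !rlkerZ // -!EFinM; congr EFin; ring.
    + apply: emeasurable_funM; last exact: (mf b).
      by apply: (measurableT_comp (mf a)); exact: measurable_funB.
    + by move=> x _; rewrite mule_ge0 // fge.
    + by rewrite lee_fin mulr_ge0 ?powR_ge0.
  - apply: emeasurable_funM => //.
    by apply: (measurableT_comp (mf a)); exact: measurable_funB.
  - by move=> x; rewrite mule_ge0 // fge.
have := @laplace_conv R (EFin \o rlker a) (EFin \o rlker b) 1 (mf a) (fun x => fge a x a0) (mf b) (fun x => fge b x b0).
rewrite !laplace_rlker1 // mul1e /laplace.
have -> : (\int[leb]_t ((expR (- (1 * t)))%:E *
    conv (EFin \o rlker a) (EFin \o rlker b) t) =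
    ((Gamma (a + b))%:E * B) * laplace (EFin \o rlker (a + b)) 1)%E.
  rewrite /laplace -ge0_integralZl //=.
  - apply: eq_integral => x _; rewrite scale EFinM.
    by rewrite muleAC muleCA.
  - apply: emeasurable_funM; [exact: measurable_expZ|exact: mf].
  - by move=> x _; rewrite mule_ge0 // ?fge // lee_fin expR_ge0.
  - by rewrite mule_ge0 // lee_fin ltW // Gamma_gt0.
rewrite laplace_rlker1 // mule1 => E.
by rewrite scale EFinM -muleA muleCA E mule1.
Qed.

(** * The Mittag-Leffler series *)

(** The coefficients of an entire function.  This formulation is stable under
    formal differentiation, which makes the sum differentiable everywhere. *)
Definition superexp_small (R : realType) (c : nat -> R) :=
  forall r : R, 0 < r -> exists2 C : R, 0 <= C & forall n, `|c n| <= C * r ^+ n.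

(** A bound from some rank on is enough: the finitely many other terms are
    absorbed by the constant. *)
Lemma superexp_small_near (R : realType) (c : nat -> R) :
  (forall r : R, 0 < r -> exists C : R, \forall n \near \oo, `|c n| <= C * r ^+ n) ->
  superexp_small c.
Proof.
move=> h r r0; have [C [N _ hN]] := h r r0.
pose S := \sum_(i < N) `|c i| / r ^+ i.
have S0 : 0 <= S by apply: sumr_ge0 => i _; rewrite divr_ge0 // exprn_ge0 // ltW.
exists (`|C| + S) => [|n]; first by rewrite addr_ge0.
have rn : 0 < r ^+ n by rewrite exprn_gt0.
have [nN|nN] := ltnP n N; last first.
  apply: (le_trans (hN n nN)); rewrite ler_pM2r //.
  by apply: (le_trans (ler_norm C)); rewrite lerDl.
rewrite -ler_pdivrMr // (@le_trans _ _ S) ?lerDr // /S (bigD1 (Ordinal nN)) //= lerDl.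
by apply: sumr_ge0 => i _; rewrite divr_ge0 // exprn_ge0 // ltW.
Qed.

Lemma superexp_small_cvg (R : realType) (c : nat -> R) (x : R) :
  superexp_small c -> cvgn (pseries c x).
Proof.
move=> sc.
have x1 : 0 < 2 * (`|x| + 1) by rewrite mulr_gt0 // ltr_wpDl.
have hx : (2 * (`|x| + 1))^-1 * `|x| <= 2^-1.
  by rewrite ler_pdivrMl // mulrAC divff // mul1r lerDl.
have [C C0 hC] := sc (2 * (`|x| + 1))^-1 (ltac:(by rewrite invr_gt0)).
apply: normed_cvg; rewrite /normed_series_of /=.
apply: (@series_le_cvg _ _ (geometric C 2^-1)).
- by [].
- by move=> n; apply: geometric_ge0.
- move=> n; rewrite normrM normrX /=.
  apply: (le_trans (ler_wpM2r _ (hC n))); first by rewrite exprn_ge0.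
  rewrite -mulrA ler_wpM2l // -exprMn; apply: lerXn2r; last exact: hx.
    by rewrite nnegrE mulr_ge0 // invr_ge0 ltW.
  by rewrite nnegrE.
- by apply: is_cvg_geometric_series; rewrite ger0_norm // invf_lt1 // ltr1n.
Qed.

(** The factor [n + 1] is at most [2^(n+1)], so halving the ratio [r] absorbs
    it. *)
Lemma superexp_small_diffs (R : realType) (c : nat -> R) :
  superexp_small c -> superexp_small (pseries_diffs c).
Proof.
move=> sc r r0; have r20 : 0 < r / 2 by rewrite divr_gt0.
have [C C0 hC] := sc _ r20.
exists (C * r) => [|n]; first by rewrite mulr_ge0 // ltW.
rewrite /pseries_diffs normrM normr_nat.
apply: (le_trans (ler_wpM2l _ (hC n.+1))) => //.
have -> : n.+1%:R * (C * (r / 2) ^+ n.+1) = (n.+1%:R / 2 ^+ n.+1) * (C * r * r ^+ n).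
  by rewrite exprMn exprVn [r ^+ n.+1]exprS; ring.
have D0 : 0 <= C * r * r ^+ n by rewrite mulr_ge0 ?exprn_ge0 ?mulr_ge0 // ltW.
apply: ler_piMl => //; rewrite ler_pdivrMr ?exprn_gt0 // mul1r.
by rewrite -natrX ler_nat ltnW // ltn_expl.
Qed.

Lemma superexp_small_continuous (R : realType) (c : nat -> R) :
  superexp_small c -> continuous (fun x => limn (pseries c x)).
Proof.
move=> sc x; apply: differentiable_continuous; apply/derivable1_diffP.
have sd := superexp_small_diffs sc; have sdd := superexp_small_diffs sd.
suff : is_derive x 1 (fun x => limn (pseries c x)) (limn (pseries (pseries_diffs c) x)).
  by case.
apply: (@pseries_snd_diffs _ _ (`|x| + 1)); try exact: superexp_small_cvg.
by rewrite [ltRHS]ger0_norm ?addr_ge0 // ltrDl.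
Qed.

Definition mlcoef (R : realType) (al : R) (n : nat) : R := (Gamma (al * n%:R + al))^-1.

Lemma mlcoef_gt0 (R : realType) (al : R) n : 0 < al -> 0 < mlcoef al n.
Proof. by move=> a0; rewrite invr_gt0 Gamma_gt0 // ltr_wpDl // mulr_ge0 // ltW. Qed.

Lemma superexp_small_mlcoef (R : realType) (al : R) : 0 < al -> superexp_small (mlcoef al).
Proof.
move=> a0; apply: superexp_small_near => r r0.
(* With this [M], the lower bound on [Gamma] decays exactly like [r^n]. *)
pose M := r `^ (- al^-1).
have M0 : 0 < M by rewrite powR_gt0.
exists (expR (M + 1) * M `^ (1 - al)); near=> n.
have n1 : 1 <= al * n%:R + al.
  have : al^-1 <= n%:R.
    rewrite ltW // (lt_le_trans (archi_boundP _)) ?invr_ge0 ?(ltW a0) //.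
    by rewrite ler_nat; near: n; exact: nbhs_infty_ge.
  by rewrite -[al^-1]mulr1 ler_pdivrMl // => /le_trans; apply; rewrite lerDl ltW.
rewrite gtr0_norm ?mlcoef_gt0 // /mlcoef.
have L0 : 0 < M `^ (al * n%:R + al - 1) * expR (- (M + 1)).
  by rewrite mulr_gt0 ?expR_gt0 ?powR_gt0.
have := Gamma_lower_bound n1 M0; rewrite -lef_pV2 ?posrE ?(lt_le_trans L0) //; last first.
  exact: Gamma_lower_bound.
move=> /le_trans; apply; rewrite invfM expRN invrK -powRN mulrC -mulrA ler_wpM2l ?expR_ge0 //.
have -> : - (al * n%:R + al - 1) = (1 - al) + (- al) * n%:R by ring.
rewrite powRD; last by rewrite (gt_eqF M0) implybT.
have key : M `^ (- al) = r by rewrite /M -powRrM mulrNN mulVf ?gt_eqF // powRr1 // ltW.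
by rewrite powRrM key powR_mulrn // ltW.
Unshelve. all: by end_near. Qed.

(** The Mittag-Leffler function with both parameters equal, written as a power
    series in order to use the theory of [pseries]. *)
Definition ml_diag (R : realType) (al x : R) := limn (pseries (mlcoef al) x).

Lemma mittag_lefflerE (R : realType) (al x : R) : mittag_leffler al al x = ml_diag al x.
Proof.
rewrite /mittag_leffler /ml_diag /pseries; congr (limn (series _)).
by apply/funext => n; rewrite /mlcoef mulrC.
Qed.

Lemma continuous_ml_diag (R : realType) (al : R) : 0 < al -> continuous (@ml_diag R al).
Proof. by move=> a0; apply: superexp_small_continuous; exact: superexp_small_mlcoef. Qed.

Lemma ml_diag0 (R : realType) (al : R) : ml_diag al 0 = (Gamma al)^-1.
Proof.
rewrite /ml_diag; apply: lim_near_cst => //; near=> n.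
have n0 : (0 < n)%N by near: n; exact: nbhs_infty_gt.
rewrite -(prednK n0) /pseries /series /= big_nat_recl //= big1 ?addr0 => [|i _].
  by rewrite expr0 mulr1 /mlcoef mulr0 add0r.
by rewrite expr0n mulr0.
Unshelve. all: by end_near. Qed.

(** The absolute value of the term of index [n] in the alternating series of
    [g al t]: it is again a Riemann-Liouville kernel. *)
Definition mlterm (R : realType) (al : R) (n : nat) (t : R) : R := rlker (al * n.+1%:R) t.

(** The series of [g] is split by parity into two series of nonnegative terms,
    which may be convolved term by term by monotone convergence. *)
Definition evensum (R : realType) (al t : R) : \bar R :=
  (\sum_(n <oo) (mlterm al n.*2 t)%:E)%E.

Definition oddsum (R : realType) (al t : R) : \bar R :=
  (\sum_(n <oo) (mlterm al n.*2.+1 t)%:E)%E.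

Lemma mlterm_ge0 (R : realType) (al t : R) n : 0 < al -> 0 <= mlterm al n t.
Proof. by move=> a0; rewrite rlker_ge0 // mulr_gt0. Qed.

Lemma mltermE (R : realType) (al t : R) n : 0 < t ->
  mlterm al n t = t `^ (al - 1) * (mlcoef al n * (t `^ al) ^+ n).
Proof.
move=> t0; rewrite /mlterm /rlker t0 /mlcoef.
have -> : al * n.+1%:R = al * n%:R + al by rewrite -natr1; ring.
have -> : al * n%:R + al - 1 = (al - 1) + al * n%:R by ring.
rewrite powRD; last by rewrite (gt_eqF t0) implybT.
by rewrite powRrM powR_mulrn ?powR_ge0 //; ring.
Qed.

Lemma mlterm_geometric (R : realType) (al t : R) : 0 < al -> 0 < t ->
  exists2 C : R, 0 <= C & forall n, mlterm al n t <= geometric C 2^-1 n.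
Proof.
move=> a0 t0; have x0 : 0 < t `^ al by rewrite powR_gt0.
have [C C0 hC] := superexp_small_mlcoef a0 (ltac:(by rewrite invr_gt0 mulr_gt0) : 0 < (2 * t `^ al)^-1).
exists (t `^ (al - 1) * C) => [|n]; first by rewrite mulr_ge0 ?powR_ge0.
rewrite mltermE //= -mulrA ler_wpM2l ?powR_ge0 //.
have := hC n; rewrite gtr0_norm ?mlcoef_gt0 // => h.
apply: (le_trans (ler_wpM2r _ h)); first by rewrite exprn_ge0 // ltW.
by rewrite -mulrA -exprMn invfM -mulrA mulVf ?gt_eqF // mulr1.
Qed.

(** The partial sums of even length of the alternating series are differences
    of partial sums of the two nonnegative series. *)
Lemma even_odd_sum (R : realType) (al t : R) : 0 < al -> 0 < t ->
  exists p q : R, [/\ evensum al t = p%:E, oddsum al t = q%:E & g al t = p - q].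
Proof.
move=> a0 t0; have [C C0 hC] := mlterm_geometric a0 t0.
pose up n := mlterm al n.*2 t; pose uq n := mlterm al n.*2.+1 t.
have half : `|2^-1 : R| < 1 by rewrite ger0_norm // invf_lt1 // ltr1n.
have geole i j : (i <= j)%N -> geometric C 2^-1 j <= geometric C (2^-1 : R) i.
  by move=> ij; rewrite /= ler_wpM2l // ler_wiXn2l // ?invr_ge0 // invf_le1 // ler1n.
have cp : cvgn (series up).
  apply: (@series_le_cvg _ _ (geometric C 2^-1)).
  - by move=> n; exact: mlterm_ge0.
  - by move=> n; apply: geometric_ge0.
  - by move=> n; apply: (le_trans (hC _)); apply: geole; rewrite -addnn leq_addr.
  - exact: is_cvg_geometric_series.
have cq : cvgn (series uq).
  apply: (@series_le_cvg _ _ (geometric C 2^-1)).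
  - by move=> n; exact: mlterm_ge0.
  - by move=> n; apply: geometric_ge0.
  - by move=> n; apply: (le_trans (hC _)); apply: geole; rewrite ltnW // ltnS -addnn leq_addr.
  - exact: is_cvg_geometric_series.
have lE (u : nat -> R) : cvgn (series u) ->
    (\sum_(n <oo) (u n)%:E)%E = (limn (series u))%:E.
  move=> cu; rewrite -EFin_lim //; congr (limn _); apply/funext => n.
  by rewrite /= /series /= sumEFin.
exists (limn (series up)), (limn (series uq)).
split; [by rewrite -(lE up cp)|by rewrite -(lE uq cq)|].
rewrite /g mittag_lefflerE.
have cml := @superexp_small_cvg _ _ (- t `^ al) (superexp_small_mlcoef a0).
have c2 : (fun n => t `^ (al - 1) * pseries (mlcoef al) (- t `^ al) n.*2) @ \oo -->
    t `^ (al - 1) * ml_diag al (- t `^ al).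
  apply: cvgM; first exact: cvg_cst.
  apply: (@cvg_comp _ _ _ (fun n => n.*2) (pseries (mlcoef al) (- t `^ al)) \oo \oo); last exact: cml.
  move=> A [N _ NA]; exists N => // n /= Nn; apply: NA => /=.
  by rewrite (leq_trans Nn) // -addnn leq_addr.
have c3 := cvgB cp cq.
have E : (fun n => t `^ (al - 1) * pseries (mlcoef al) (- t `^ al) n.*2) = series up - series uq.
  apply/funext => n; rewrite !fctE; elim: n => [|n IH].
    by rewrite /pseries /series /= !big_geq // mulr0 subr0.
  rewrite doubleS /pseries !seriesSr mulrDr mulrDr IH.
  rewrite /up /uq !mltermE // [X in _ + _ * X + _ = _]/= [X in _ + _ * X = _]/= [(- _) ^+ n.*2.+1]exprS.
  have -> : (- t `^ al) ^+ n.*2 = (t `^ al) ^+ n.*2.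
    by rewrite exprNn -signr_odd odd_double mul1r.
  rewrite [(t `^ al) ^+ n.*2.+1]exprS.
  move: (mlcoef al n.*2) (mlcoef al n.*2.+1) (series up n) (series uq n) => m1 m2 x y.
  by ring.
rewrite E in c2.
exact: (cvg_unique _ c2 (c3 _)).
Qed.

(** * The Volterra equation and the positivity of g *)

Lemma measurable_EFin_rlker (R : realType) (a : R) : measurable_fun setT (EFin \o @rlker R a).
Proof. by apply/measurable_EFinP; exact: measurable_rlker. Qed.

Lemma measurable_conv_integrand (R : realType) (f h : R -> \bar R) (t : R) :
  measurable_fun setT f -> measurable_fun setT h ->
  measurable_fun setT (fun s : R => (f (t - s)%R * h s)%E).
Proof.
move=> mf mh; apply: emeasurable_funM => //.
by apply: (measurableT_comp mf); exact: measurable_funB.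
Qed.

Lemma conv_nneseries (R : realType) (f : R -> R) (u : nat -> R -> \bar R) (t : R) :
  measurable_fun setT f -> (forall x, 0 <= f x) ->
  (forall n, measurable_fun setT (u n)) -> (forall n x, 0 <= u n x)%E ->
  conv (EFin \o f) (fun s => \sum_(n <oo) u n s)%E t =
  (\sum_(n <oo) conv (EFin \o f) (u n) t)%E.
Proof.
move=> mf f0 mu u0; rewrite /conv -integral_nneseries //=.
- by apply: eq_integral => s _; rewrite nneseriesZl.
- move=> n; apply: (@measurable_conv_integrand _ (EFin \o f) (u n)) => //.
  exact/measurable_EFinP.
- by move=> n x _; rewrite mule_ge0 // lee_fin.
Qed.

Lemma conv_mlterm (R : realType) (al t : R) n : 0 < al ->
  conv (EFin \o rlker al) (EFin \o mlterm al n) t = (mlterm al n.+1 t)%:E.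
Proof.
move=> a0; rewrite /mlterm; have -> : al * n.+2%:R = al + al * n.+1%:R.
  by rewrite -[n.+2%:R]natr1; ring.
by apply: conv_rlker => //; rewrite mulr_gt0.
Qed.

(** Convolution with [rlker al] shifts the index of the terms by one, so it maps
    the even part to the odd part; [conv_oddsum] is the companion fact. *)
Lemma conv_evensum (R : realType) (al t : R) : 0 < al ->
  conv (EFin \o rlker al) (evensum al) t = oddsum al t.
Proof.
move=> a0; rewrite (@conv_nneseries _ _ (fun n => EFin \o mlterm al n.*2)).
- by apply: eq_eseriesr => n _; exact: conv_mlterm.
- exact: measurable_rlker.
- by move=> x; exact: rlker_ge0.
- by move=> n; exact: measurable_EFin_rlker.
- by move=> n x; rewrite lee_fin mlterm_ge0.
Qed.

Lemma nneseries_recSl (R : realType) (u : nat -> \bar R) : (forall n, 0 <= u n)%E ->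
  (\sum_(n <oo) u n = u 0%N + \sum_(n <oo) u n.+1)%E.
Proof.
move=> u0; rewrite nneseries_recl // -nneseries_addn //.
by congr (_ + _)%E; apply: eq_eseriesr => n _; rewrite addn1.
Qed.

Lemma conv_oddsum (R : realType) (al t : R) : 0 < al ->
  ((rlker al t)%:E + conv (EFin \o rlker al) (oddsum al) t = evensum al t)%E.
Proof.
move=> a0; rewrite (@conv_nneseries _ _ (fun n => EFin \o mlterm al n.*2.+1)).
- have -> : evensum al t = ((mlterm al 0.*2 t)%:E + \sum_(n <oo) (mlterm al n.+1.*2 t)%:E)%E.
    apply: (@nneseries_recSl R (fun n => (mlterm al n.*2 t)%:E)) => n.
    by rewrite lee_fin mlterm_ge0.
  have -> : mlterm al 0.*2 t = rlker al t by rewrite /mlterm double0 mulr1.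
  suff -> : (\sum_(n <oo) conv (EFin \o rlker al) (EFin \o mlterm al n.*2.+1) t =
      \sum_(n <oo) (mlterm al n.+1.*2 t)%:E)%E by [].
  by apply: eq_eseriesr => n _; exact: conv_mlterm.
- exact: measurable_rlker.
- by move=> x; exact: rlker_ge0.
- by move=> n; exact: measurable_EFin_rlker.
- by move=> n x; rewrite lee_fin mlterm_ge0.
Qed.

Lemma gE (R : realType) (al : R) : g al = (fun t => t `^ (al - 1) * ml_diag al (- t `^ al)).
Proof. by apply/funext => t; rewrite /g mittag_lefflerE. Qed.

Lemma measurable_g (R : realType) (al : R) : 0 < al -> measurable_fun setT (@g R al).
Proof.
move=> a0; rewrite gE; apply: measurable_funM; first exact: measurable_powR.
apply: measurableT_comp.
  by apply: continuous_measurable_fun; exact: continuous_ml_diag.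
by apply: measurable_funN; exact: measurable_powR.
Qed.

Lemma continuous_g (R : realType) (al t : R) : 0 < al -> 0 < t ->
  {for t, continuous (@g R al)}.
Proof.
move=> a0 t0; rewrite gE; apply: cvgM; first exact: continuous_powR.
apply: (@cvg_comp _ _ _ (fun t => - t `^ al) (ml_diag al) _ (nbhs (- t `^ al))).
  by apply: cvgN; exact: continuous_powR.
exact: continuous_ml_diag.
Qed.

(** The positive part of [g], extended by zero.  Convolutions are taken only of
    nonnegative functions, so this replaces [g] until its positivity is known;
    afterwards both agree on the positive half-line ([gplusE]). *)
Definition gplus (R : realType) (al t : R) : R :=
  if 0 < t then Num.max (g al t) 0 else 0.

Lemma gplus_ge0 (R : realType) (al t : R) : 0 <= gplus al t.
Proof. by rewrite /gplus; case: ifP => // _; rewrite le_max lexx orbT. Qed.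

Lemma measurable_gplus (R : realType) (al : R) : 0 < al -> measurable_fun setT (@gplus R al).
Proof.
move=> a0; apply: measurable_fun_ifT.
- exact: measurable_fun_ltr.
- by apply: measurable_maxr => //; exact: measurable_g.
- exact: measurable_cst.
Qed.

Lemma measurable_oddsum (R : realType) (al : R) : 0 < al -> measurable_fun setT (@oddsum R al).
Proof.
move=> a0; apply: ge0_emeasurable_sum.
  by move=> k x _ _; rewrite lee_fin mlterm_ge0.
by move=> k _; exact: measurable_EFin_rlker.
Qed.

Lemma oddsum_ge0 (R : realType) (al t : R) : 0 < al -> (0 <= oddsum al t)%E.
Proof. by move=> a0; apply: nneseries_ge0 => n _ _; rewrite lee_fin mlterm_ge0. Qed.

Lemma evensum_le0 (R : realType) (al t : R) : t <= 0 -> evensum al t = 0%E.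
Proof. by move=> t0; apply: eseries0 => n _ _; rewrite /mlterm /rlker ltNge t0. Qed.

Lemma oddsum_le0 (R : realType) (al t : R) : t <= 0 -> oddsum al t = 0%E.
Proof. by move=> t0; apply: eseries0 => n _ _; rewrite /mlterm /rlker ltNge t0. Qed.

Lemma rlker_le0 (R : realType) (a t : R) : t <= 0 -> rlker a t = 0.
Proof. by move=> t0; rewrite /rlker ltNge t0. Qed.

Lemma rlker_gt0 (R : realType) (a t : R) : 0 < a -> 0 < t -> 0 < rlker a t.
Proof. by move=> a0 t0; rewrite /rlker t0 divr_gt0 ?powR_gt0 ?Gamma_gt0. Qed.

(** The equation [k * g = k - g] at time [t].  It involves [g] only before
    time [t], so positivity is needed only there. *)
Lemma volterra_gplus (R : realType) (al t : R) : 0 < al -> 0 < t ->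
  (forall s, 0 < s < t -> 0 <= g al s) ->
  conv (EFin \o rlker al) (EFin \o gplus al) t = (rlker al t - g al t)%:E.
Proof.
move=> a0 t0 gp.
have E : (conv (EFin \o rlker al) (EFin \o gplus al) t +
    conv (EFin \o rlker al) (oddsum al) t = oddsum al t)%E.
  rewrite -[RHS]conv_evensum // /conv -ge0_integralD //=.
  - apply: eq_integral => s _; rewrite -ge0_muleDr ?lee_fin ?gplus_ge0 ?oddsum_ge0 //.
    have [s0|s0] := leP s 0.
      by rewrite evensum_le0 // oddsum_le0 // /gplus ltNge s0 /= adde0.
    have [ts|st] := leP t s.
      by rewrite rlker_le0 ?subr_le0 // !mul0e.
    congr (_ * _)%E; have [p [q [-> -> gpq]]] := even_odd_sum a0 s0.
    rewrite /gplus s0 max_l; last by rewrite gp // s0 st.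
    by rewrite gpq -EFinD subrK.
  - by move=> x _; rewrite mule_ge0 // lee_fin ?rlker_ge0 ?gplus_ge0.
  - apply: (@measurable_conv_integrand _ (EFin \o rlker al) (EFin \o gplus al)).
      exact: measurable_EFin_rlker.
    by apply/measurable_EFinP; exact: measurable_gplus.
  - by move=> x _; rewrite mule_ge0 ?oddsum_ge0 // lee_fin ?rlker_ge0.
  - apply: (@measurable_conv_integrand _ (EFin \o rlker al) (oddsum al)).
      exact: measurable_EFin_rlker.
    exact: measurable_oddsum.
have E' := conv_oddsum t a0.
have [p [q [Ep Eq Eg]]] := even_odd_sum a0 t0.
move: E E'; rewrite Ep Eq Eg.
move: (conv _ (oddsum al) t) (conv _ _ t) => [r| |] [r'| |] //.
by rewrite -!EFinD => -[E] -[E']; congr EFin; lra.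
Qed.

Lemma le0_powR_anti (R : realType) (a x y : R) : a <= 0 -> 0 < x -> x <= y -> y `^ a <= x `^ a.
Proof.
move=> a0 x0 xy; have y0 := lt_le_trans x0 xy.
rewrite -[a]opprK (powRN y (- a)) (powRN x (- a)) lef_pV2 ?posrE ?powR_gt0 //.
by apply: ge0_ler_powR => //; rewrite ?oppr_ge0 // nnegrE ltW.
Qed.

(** The ratio [k (x + h) / k x] is nondecreasing in [x]; here [h = T - t]. *)
Lemma rlker_logconvex (R : realType) (al s t T : R) : 0 < al -> al < 1 ->
  0 < s -> s < t -> t <= T ->
  rlker al (T - s) * rlker al t <= rlker al T * rlker al (t - s).
Proof.
move=> a0 a1 s0 st tT; have sT := lt_le_trans st tT.
have t0 := lt_trans s0 st; have T0 := lt_trans s0 sT.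
rewrite /rlker !subr_gt0 st sT t0 T0 mulrACA [leRHS]mulrACA.
rewrite ler_wpM2r ?mulr_ge0 ?invr_ge0 ?(ltW (Gamma_gt0 _)) //.
have Ts0 : 0 < T - s by rewrite subr_gt0.
have ts0 : 0 < t - s by rewrite subr_gt0.
rewrite -(powRM _ (ltW Ts0) (ltW t0)) -(powRM _ (ltW T0) (ltW ts0)).
apply: le0_powR_anti; [by rewrite subr_le0 ltW|by rewrite mulr_gt0|nra].
Qed.

(** Near [0], the sign is that of the constant term of the series. *)
Lemma g_gt0_near0 (R : realType) (al : R) : 0 < al ->
  exists2 e : R, 0 < e & forall t, 0 < t < e -> 0 < g al t.
Proof.
move=> a0; have := @continuous_ml_diag R al a0 0; rewrite /continuous_at ml_diag0.
have G0 : 0 < (Gamma al)^-1 by rewrite invr_gt0 Gamma_gt0.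
move=> /cvgr_gt/(_ _ G0) /nbhs_ballP [e e0 he].
exists (e `^ al^-1) => [|t /andP[t0 te]]; first exact: powR_gt0.
rewrite gE mulr_gt0 ?powR_gt0 //; apply: he.
rewrite /ball /= sub0r opprK ger0_norm ?powR_ge0 //.
have -> : e = (e `^ al^-1) `^ al by rewrite -powRrM mulVf ?gt_eqF // powRr1 // ltW.
by apply: gt0_ltr_powR; rewrite ?nnegrE ?powR_ge0 // ltW.
Qed.

Lemma Gamma1_rlker1 (R : realType) (t : R) : 0 < t -> Gamma 1 * rlker 1 t = 1 :> R.
Proof. by move=> t0; rewrite /rlker t0 subrr powRr0 mul1r divff // gt_eqF // Gamma_gt0. Qed.

(** The convolution at time [T] is compared with the one at the earlier time
    [t].  Before [t], log-convexity gives
    [k (T - s) <= k T / k t * k (t - s)]; between [t] and [T], [g] is at most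
    [M], and the integral of [k] over an interval slightly longer than [t, T]
    is the convolution of [k] with a multiple of [rlker 1].  Any [b < t]
    may start that interval, which avoids discussing its endpoint. *)
Lemma volterra_compare (R : realType) (al b t T M : R) : 0 < al -> al < 1 ->
  0 < t -> b < t -> t <= T -> 0 <= M ->
  (forall s, 0 < s < T -> 0 <= g al s) ->
  (forall s, t <= s -> s < T -> g al s <= M) ->
  rlker al T - g al T <= rlker al T / rlker al t * (rlker al t - g al t)
     + M * Gamma 1 * rlker (al + 1) (T - b).
Proof.
move=> a0 a1 t0 bt tT M0 gp gM.
have T0 := lt_le_trans t0 tT.
have mk : measurable_fun setT (EFin \o @rlker R al) by exact: measurable_EFin_rlker.
have mG : measurable_fun setT (EFin \o gplus al).
  by apply/measurable_EFinP; exact: measurable_gplus.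
have rho0 : 0 <= rlker al T / rlker al t by rewrite divr_ge0 ?rlker_ge0.
have G1 : 0 < Gamma 1 :> R by exact: Gamma_gt0.
have MG0 : 0 <= M * Gamma 1 by rewrite mulr_ge0 // ltW.
suff : ((rlker al T - g al T)%:E <= (rlker al T / rlker al t)%:E * (rlker al t - g al t)%:E
    + (M * Gamma 1)%:E * (rlker (al + 1) (T - b))%:E)%E by rewrite -!EFinM -EFinD lee_fin.
rewrite -(volterra_gplus a0 T0 gp) -(volterra_gplus a0 t0); last first.
  by move=> s /andP[s0 st]; rewrite gp // s0 (lt_le_trans st).
rewrite -conv_rlker //.
have -> : conv (EFin \o rlker al) (EFin \o rlker 1) (T - b) =
    (\int[leb]_s ((rlker al (T - s))%:E * (rlker 1 (s - b))%:E))%E.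
  rewrite /conv.
  rewrite -(@integral_affine R 1 (- b) (fun s => (EFin \o rlker al) (T - b - s)%R * (EFin \o rlker 1) s)%E ltr01); last 2 first.
  - apply: (@measurable_conv_integrand _ (EFin \o rlker al) (EFin \o rlker 1) (T - b)) mk _.
    exact: measurable_EFin_rlker.
  - by move=> s; rewrite mule_ge0 // lee_fin rlker_ge0.
  rewrite mul1e; apply: eq_integral => s _ /=; rewrite mul1r.
  by congr ((rlker al _)%:E * _)%E; ring.
have m1 : measurable_fun setT (fun s : R => ((rlker al (t - s))%:E * (gplus al s)%:E)%E).
  exact: (@measurable_conv_integrand _ (EFin \o rlker al) (EFin \o gplus al) t mk mG).
have m2 : measurable_fun setT (fun s : R => ((rlker al (T - s))%:E * (gplus al s)%:E)%E).
  exact: (@measurable_conv_integrand _ (EFin \o rlker al) (EFin \o gplus al) T mk mG).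
have m3 : measurable_fun setT (fun s : R => ((rlker al (T - s))%:E * (rlker 1 (s - b))%:E)%E).
  apply: emeasurable_funM.
    by apply: (measurableT_comp mk); exact: measurable_funB.
  by apply: (measurableT_comp (@measurable_EFin_rlker R 1)); exact: measurable_funB.
have kp (s : R) : 0 <= rlker al s by exact: rlker_ge0.
have k1p (s : R) : 0 <= rlker 1 s by exact: rlker_ge0.
have Gp := gplus_ge0 al.
rewrite /conv -ge0_integralZl //=; last by move=> s _; rewrite mule_ge0 ?lee_fin.
rewrite -ge0_integralZl //=; last by move=> s _; rewrite mule_ge0 ?lee_fin.
rewrite -ge0_integralD //=; last 4 first.
- by move=> s _; rewrite !mule_ge0 ?lee_fin.
- exact: emeasurable_funM.
- by move=> s _; rewrite !mule_ge0 ?lee_fin.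
- exact: emeasurable_funM.
apply: ge0_le_integral => //=.
- by move=> s _; rewrite mule_ge0 ?lee_fin.
- by apply: emeasurable_funD; exact: emeasurable_funM.
move=> s _; rewrite -!EFinM -EFinD lee_fin.
have p1 := mulr_ge0 rho0 (mulr_ge0 (kp (t - s)) (Gp s)).
have p2 := mulr_ge0 MG0 (mulr_ge0 (kp (T - s)) (k1p (s - b))).
have [s0|s0] := leP s 0.
  by rewrite {1}/gplus ltNge s0 /= mulr0 addr_ge0.
have [Ts|sT] := leP T s.
  by rewrite {1}rlker_le0 ?subr_le0 // mul0r addr_ge0.
have [ts|st] := leP t s.
  apply: (@le_trans _ _ (M * Gamma 1 * (rlker al (T - s) * rlker 1 (s - b)))); last first.
    by rewrite lerDr.
  have -> : M * Gamma 1 * (rlker al (T - s) * rlker 1 (s - b)) =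
     rlker al (T - s) * (M * (Gamma 1 * rlker 1 (s - b))) by ring.
  rewrite Gamma1_rlker1 ?subr_gt0 ?(lt_le_trans bt) // mulr1 ler_wpM2l //.
  by rewrite /gplus s0 ge_max M0 gM.
apply: (@le_trans _ _ (rlker al T / rlker al t * (rlker al (t - s) * gplus al s))); last first.
  by rewrite lerDl.
rewrite mulrA ler_wpM2r // mulrAC ler_pdivlMr ?rlker_gt0 //.
exact: rlker_logconvex.
Qed.

(** Let [T] be the infimum of the points where [g] is nonpositive, and let
    [u] maximise [g] on a short interval ending at [T].  Then [u] lies strictly
    before [T], and [volterra_compare] with [M = g u] bounds [g u * k T / k u]
    by [g u / 4], although [k T / k u] is at least [1/2]. *)
Lemma g_gt0 (R : realType) (al t : R) : 0 < al -> al < 1 -> 0 < t -> 0 < g al t.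
Proof.
have F (A B : R) : A != 0 -> B != 0 -> A * (B / (4 * A) / B) = 4^-1.
  by move=> A0 B0; field; rewrite A0 B0.
move=> a0 a1 t0; rewrite ltNge; apply/negP => gt.
have [e e0 he] := g_gt0_near0 a0.
pose S : set R := [set s | 0 < s /\ g al s <= 0].
have Se s : S s -> e <= s.
  move=> [s0 gs]; rewrite leNgt; apply/negP => se.
  by have := he s; rewrite s0 se => /(_ isT); rewrite ltNge gs.
have hS : has_inf S by split; [exists t|exists e => s /Se].
pose T := inf S.
have eT : e <= T by apply: lb_le_inf; [exists t|move=> s /Se].
have T0 : 0 < T := lt_le_trans e0 eT.
have gpos s : 0 < s -> s < T -> 0 < g al s.
  move=> s0 sT; rewrite ltNge; apply/negP => gs.
  have : T <= s by apply: ge_inf; [case: hS|split].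
  by rewrite leNgt sT.
have gT : g al T <= 0.
  rewrite leNgt; apply/negP => gT.
  have := continuous_g a0 T0; move=> /cvgr_gt/(_ _ gT) /nbhs_ballP [r r0 hr].
  have [s [s0 gs] sT] := inf_adherent r0 hS.
  have Ts : T <= s by apply: ge_inf; [case: hS|split].
  have : 0 < g al s.
    by apply: hr; rewrite /ball /= distrC ger0_norm ?subr_ge0 // ltrBlDl.
  by rewrite ltNge gs.
have G1 : 0 < Gamma 1 :> R by exact: Gamma_gt0.
have Ga : 0 < Gamma (al + 1) by rewrite Gamma_gt0 // addr_gt0.
(* The length [d] makes [Gamma 1 * rlker (al + 1) d <= 1/4], and it is at most
   [T / 2] so that [k] at most doubles on the interval considered. *)
pose y := Gamma (al + 1) / (4 * Gamma 1).
have y0 : 0 < y by rewrite divr_gt0 // mulr_gt0.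
pose d := Num.min (T / 2) (y `^ al^-1).
have d0 : 0 < d by rewrite lt_min divr_gt0 //= powR_gt0.
have d2 : d <= T / 2 by rewrite ge_min lexx.
have dy : d `^ al <= y.
  have -> : y = (y `^ al^-1) `^ al by rewrite -powRrM mulVf ?gt_eqF // powRr1 // ltW.
  apply: ge0_ler_powR; rewrite ?nnegrE ?powR_ge0 ?(ltW a0) ?(ltW d0) //.
  by rewrite ge_min lexx orbT.
have Td : 0 < T - d / 2.
  have H (x1 x2 : R) : 0 < x1 -> x2 <= x1 / 2 -> 0 < x1 - x2 / 2 by clear; lra.
  exact: H.
have dT : T - d / 2 < T by rewrite ltrBlDr ltrDl divr_gt0.
have [] := @EVT_max _ (g al) (T - d / 2) T (ltW dT).
  apply: continuous_in_subspaceT => x; rewrite inE /= in_itv /= => /andP[x1 _].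
  by apply: continuous_g => //; exact: lt_le_trans x1.
move=> u; rewrite in_itv /= => /andP[u1 u2] hu.
have u0 : 0 < u := lt_le_trans Td u1.
have M0 : 0 < g al u.
  apply: (@lt_le_trans _ _ (g al (T - d / 2))); first exact: gpos.
  by apply: hu; rewrite in_itv /= lexx ltW.
have uT : u < T.
  by rewrite lt_neqAle u2 andbT; apply/eqP => uT; move: M0; rewrite uT ltNge gT.
have bu : T - d < u.
  by apply: lt_le_trans u1; rewrite ltrD2l ltrN2 gtr_pMr // invf_lt1 // ltr1n.
have := @volterra_compare R al (T - d) u T (g al u) a0 a1 u0 bu u2 (ltW M0).
have -> : T - (T - d) = d by rewrite opprB addrC subrK.
move=> /(_ (fun s sT => ltW (gpos s (andP sT).1 (andP sT).2))) cmp.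
have {cmp} := cmp (fun s us sT => hu s (ltac:(rewrite in_itv /=; by rewrite (le_trans u1 us) ltW))).
have kT : 0 < rlker al T by exact: rlker_gt0.
have ku : 0 < rlker al u by exact: rlker_gt0.
have small : Gamma 1 * rlker (al + 1) d <= 4^-1.
  rewrite /rlker d0 addrK -(F (Gamma 1) (Gamma (al + 1))) ?gt_eqF // ler_pM2l // ler_pM2r //.
  by rewrite invr_gt0.
have ratio : 2^-1 <= rlker al T / rlker al u.
  rewrite ler_pdivlMr // /rlker T0 u0 mulrA ler_pM2r ?invr_gt0 ?Gamma_gt0 //.
  have T20 : 0 < T / 2 by rewrite divr_gt0.
  apply: (@le_trans _ _ (2^-1 * (T / 2) `^ (al - 1))).
    rewrite ler_pM2l ?invr_gt0 //; apply: le0_powR_anti => //.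
      by rewrite subr_le0 ltW.
    apply: le_trans u1; have H (x1 x2 : R) : 0 < x1 -> x2 <= x1 / 2 -> x1 / 2 <= x1 - x2 / 2 by clear; lra.
    exact: H.
  rewrite powRM ?invr_ge0 ?(ltW T0) // mulrCA ger_pMr ?powR_gt0 //.
  rewrite mulr_powRB1 // -[leRHS](powRr0 2^-1); apply: ger_powR; last exact: ltW.
  by rewrite invr_gt0 ltr0n /= invf_le1 // ler1n.
have H (kT' gT' rho ku' M x : R) : 0 < M -> 2^-1 <= rho -> x <= 4^-1 -> gT' <= 0 ->
    rho * ku' = kT' -> ~ (kT' - gT' <= rho * (ku' - M) + M * x).
  by clear; nra.
rewrite -[g al u * _ * _]mulrA => Hc; apply: (H _ _ _ _ _ _ M0 ratio small gT _ Hc).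
by rewrite divfK // gt_eqF.
Qed.

(** * The Laplace transform of g *)

Lemma gplusE (R : realType) (al t : R) : 0 < al -> al < 1 -> 0 < t -> gplus al t = g al t.
Proof. by move=> a0 a1 t0; rewrite /gplus t0 max_l // ltW // g_gt0. Qed.

Lemma gplus_le0 (R : realType) (al t : R) : t <= 0 -> gplus al t = 0.
Proof. by move=> t0; rewrite /gplus ltNge t0. Qed.

(** The positivity of [g] discharges the hypothesis of [volterra_gplus]. *)
Lemma renewal (R : realType) (al t : R) : 0 < al -> al < 1 ->
  conv (EFin \o rlker al) (EFin \o gplus al) t = (rlker al t - gplus al t)%:E.
Proof.
move=> a0 a1; have [t0|t0] := leP t 0; last first.
  by rewrite volterra_gplus ?gplusE // => s /andP[s0 _]; rewrite ltW // g_gt0.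
rewrite rlker_le0 // gplus_le0 // subr0 /conv integral0_eq // => s _ /=.
have [s0|s0] := leP s 0; first by rewrite gplus_le0 // mule0.
by rewrite rlker_le0 ?mul0e // subr_le0 (le_trans t0) // ltW.
Qed.

Lemma gplus_le_rlker (R : realType) (al t : R) : 0 < al -> al < 1 -> gplus al t <= rlker al t.
Proof.
move=> a0 a1; rewrite -subr_ge0 -lee_fin -renewal //.
by apply: integral_ge0 => s _; rewrite mule_ge0 // lee_fin ?rlker_ge0 ?gplus_ge0.
Qed.

(** Transforming the equation [k * g + g = k] gives
    [l^(-al) L + L = l^(-al)].  By [g <= k], the function
    [k - g] which is transformed on the left is nonnegative. *)
Lemma laplace_g_gt0 (R : realType) (al l : R) : 0 < al -> al < 1 -> 0 < l ->
  laplace (EFin \o gplus al) l = ((1 + l `^ al)^-1)%:E.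
Proof.
move=> a0 a1 l0.
have mk : measurable_fun setT (EFin \o @rlker R al) by exact: measurable_EFin_rlker.
have mG : measurable_fun setT (EFin \o gplus al).
  by apply/measurable_EFinP; exact: measurable_gplus.
have kp s : (0 <= (EFin \o rlker al) s)%E by rewrite lee_fin rlker_ge0.
have Gp s : (0 <= (EFin \o gplus al) s)%E by rewrite lee_fin gplus_ge0.
have E := laplace_conv l mk kp mG Gp.
rewrite laplace_rlker // in E.
have D : (laplace (conv (EFin \o rlker al) (EFin \o gplus al)) l +
   laplace (EFin \o gplus al) l = laplace (EFin \o rlker al) l)%E.
  have -> : conv (EFin \o rlker al) (EFin \o gplus al) = fun t => (rlker al t - gplus al t)%:E.
    by apply/funext => t; rewrite renewal.
  have me := @measurable_expZ R l.
  rewrite /laplace -ge0_integralD //=.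
  - apply: eq_integral => t _; rewrite -!EFinM -EFinD; congr EFin; ring.
  - by move=> t _; rewrite mule_ge0 ?lee_fin ?expR_ge0 // subr_ge0 gplus_le_rlker.
  - apply: emeasurable_funM => //; apply/measurable_EFinP; apply: measurable_funB.
      exact: measurable_rlker.
    exact: measurable_gplus.
  - by move=> t _; rewrite mule_ge0 ?lee_fin ?expR_ge0 ?gplus_ge0.
  - exact: emeasurable_funM.
move: D; rewrite E laplace_rlker //.
have : (0 <= laplace (EFin \o gplus al) l)%E.
  by apply: integral_ge0 => t _; rewrite mule_ge0 // lee_fin expR_ge0.
have la : 0 < l `^ al by rewrite powR_gt0.
rewrite powRN; move: (laplace _ l) => [r| |] //=.
- move=> _; rewrite -EFinM -EFinD => -[F]; congr EFin.
  have : r * (1 + l `^ al) = 1.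
    have := congr1 (fun x => x * l `^ al) F; rewrite mulrDl mulrAC mulVf ?gt_eqF // mul1r => F1.
    by rewrite mulrDr mulr1.
  have n0 : 1 + l `^ al != 0 by rewrite gt_eqF // addr_gt0.
  by move=> F'; apply: (mulIf n0); rewrite F' mulVf.
- by move=> _; rewrite gt0_muley ?lte_fin ?invr_gt0.
Qed.

(** The total mass of [g]: the value at [0] is the monotone limit of the values
    at [1 / (n + 1)]. *)
Lemma laplace_g0 (R : realType) (al : R) : 0 < al -> al < 1 ->
  laplace (EFin \o gplus al) 0 = 1%E.
Proof.
move=> a0 a1.
pose l n : R := n.+1%:R^-1.
have l0 n : 0 < l n by rewrite invr_gt0.
have mG : measurable_fun setT (EFin \o gplus al).
  by apply/measurable_EFinP; exact: measurable_gplus.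
have cl : l @ \oo --> (0 : R) by exact: cvg_harmonic.
have c1 : (fun n => laplace (EFin \o gplus al) (l n)) @ \oo --> laplace (EFin \o gplus al) 0.
  have -> : laplace (EFin \o gplus al) 0 =
      (\int[leb]_t limn (fun n => (expR (- (l n * t)))%:E * (gplus al t)%:E))%E.
    apply: eq_integral => t _; apply/esym/cvg_lim => //=.
    rewrite -EFinM; apply: cvg_EFin; first exact: nearW.
    apply: cvgM; last exact: cvg_cst.
    apply: (@cvg_comp _ _ _ (fun n => - (l n * t)) expR _ (nbhs (- (0 * t)))).
      by apply: cvgN; apply: cvgM => //; exact: cvg_cst.
    exact: continuous_expR.
  apply: cvg_monotone_convergence => //.
  - by move=> n; apply: emeasurable_funM => //; exact: measurable_expZ.
  - by move=> n t _; rewrite mule_ge0 ?lee_fin ?expR_ge0 ?gplus_ge0.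
  - move=> t _ n m nm /=; have [t0|t0] := leP t 0.
      by rewrite gplus_le0 // !mule0.
    rewrite -!EFinM lee_fin ler_wpM2r ?gplus_ge0 // ler_expR lerN2; apply: ler_wpM2r; first exact: ltW.
    by rewrite /l lef_pV2 ?posrE // ler_nat.
have c2 : (fun n => laplace (EFin \o gplus al) (l n)) @ \oo --> 1%E.
  under eq_cvg do rewrite laplace_g_gt0 //.
  apply: cvg_EFin; first exact: nearW.
  rewrite -[X in _ --> X]invr1; apply: cvgV => //.
  rewrite -[X in _ --> X]addr0; apply: cvgD; first exact: cvg_cst.
  apply: (@cvg_comp _ _ _ l (fun x => x `^ al) _ (0^'+)); last exact: powR_cvg0.
  move=> A [e /= e0 hA].
  have := cl; move=> /cvgrPdist_lt/(_ _ e0); apply: filterS => n hn.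
  by apply: hA => //=.
exact: (cvg_unique _ c1 c2).
Qed.

(** * Integrals over the half-line *)

(** Dominated convergence along the real filter at infinity, tested on
    sequences; the bound need only hold eventually. *)
Lemma Rintegral_dominated_cvg (R : realType) (D : set R) (f : R -> R -> R) (l d : R -> R) :
  measurable D ->
  (forall z, measurable_fun D (f z)) -> measurable_fun D l ->
  (forall x, D x -> f z x @[z --> +oo%R] --> l x) ->
  leb.-integrable D (EFin \o d) ->
  (\forall z \near +oo%R, forall x, D x -> `|f z x| <= d x) ->
  \int[leb]_(x in D) f z x @[z --> +oo%R] --> \int[leb]_(x in D) l x.
Proof.
move=> mD mf ml_diag fl di fd; apply/cvg_pinftyP => u uoo.
have [N _ hN] := uoo _ fd.
rewrite -(cvg_shiftn N) /=.
have mfn n : measurable_fun D (EFin \o f (u (n + N)%N)) by exact/measurable_EFinP.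
have mle : measurable_fun D (EFin \o l) by exact/measurable_EFinP.
have fln : {ae leb, forall x, D x ->
    (fun n => EFin \o f (u (n + N)%N)) ^~ x @ \oo --> (EFin \o l) x}.
  apply: aeW => x Dx /=; apply: cvg_EFin; first exact: nearW.
  have /cvg_pinftyP/(_ u uoo) := fl x Dx.
  by rewrite -(cvg_shiftn N).
have fdn : {ae leb, forall x n, D x -> (`|(EFin \o f (u (n + N)%N)) x| <= (EFin \o d) x)%E}.
  apply: aeW => x n Dx /=; rewrite lee_fin; apply: hN => //=; exact: leq_addl.
have [il _ cv] := @dominated_convergence _ _ R leb D mD _ _ _ mfn mle fln di fdn.
have ilf : (\int[leb]_(x in D) (EFin \o l) x)%E \is a fin_num by exact: integrable_fin_num.
by apply: fine_cvg; rewrite /= fineK.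
Qed.

Lemma measurable_pos (R : realType) : measurable (`]0%R, +oo[%classic : set R).
Proof. exact: measurable_itv. Qed.

Lemma integral_pos_scale (R : realType) (a : R) (F : R -> \bar R) : 0 < a ->
  measurable_fun setT F -> (forall x : R, 0 < x -> (0 <= F x)%E) ->
  (\int[leb]_(x in `]0%R, +oo[) F x = a%:E * \int[leb]_(x in `]0%R, +oo[) F (a * x)%R)%E.
Proof.
move=> a0 mF F0; pose G (x : R) := if 0 < x then F x else 0%E.
have G0 x : (0 <= G x)%E by rewrite /G; case: ifPn => // x0; exact: F0.
have mG : measurable_fun setT G.
  apply: measurable_fun_ifT => //; exact: measurable_fun_ltr.
have GE b : 0 < b ->
    (\int[leb]_(x in `]0%R, +oo[) F (b * x)%R = \int[leb]_x G (b * x)%R)%E.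
  move=> b0; rewrite integral_vanish_neg; last first.
    by move=> x x0; rewrite /G pmulr_rgt0 // ltNge x0.
  apply: eq_integral => x; rewrite inE /= in_itv /= andbT => x0.
  by rewrite /G pmulr_rgt0 // x0.
rewrite GE // -[LHS](_ : (\int[leb]_(x in `]0%R, +oo[) F (1 * x)%R)%E = _); last first.
  by apply: eq_integral => x _; rewrite mul1r.
rewrite GE // -[RHS](_ : (a%:E * \int[leb]_x G (a * x + 0)%R)%E = _); last first.
  by congr (_ * _)%E; apply: eq_integral => x _; rewrite addr0.
rewrite integral_affine //; apply: eq_integral => x _; by rewrite mul1r.
Qed.

Lemma integral_exp_g (R : realType) (al l : R) : 0 < al -> al < 1 -> 0 <= l ->
  (\int[leb]_(t in `]0%R, +oo[) (g al t * expR (- (l * t)))%:E = ((1 + l `^ al)^-1)%:E)%E.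
Proof.
move=> a0 a1 l0.
transitivity (laplace (EFin \o gplus al) l).
  rewrite /laplace [RHS]integral_vanish_neg; last by move=> t t0; rewrite /= gplus_le0 // mule0.
  apply: eq_integral => x; rewrite inE /= in_itv /= andbT => x0.
  by rewrite gplusE // -EFinM mulrC.
have [->|ln] := eqVneq l 0.
  by rewrite laplace_g0 // powR0 ?gt_eqF // addr0 invr1.
by rewrite laplace_g_gt0 // lt_neqAle eq_sym ln.
Qed.

Lemma g_integrable (R : realType) (al : R) : 0 < al -> al < 1 ->
  leb.-integrable `]0%R, +oo[ (EFin \o @g R al).
Proof.
move=> a0 a1; apply/integrableP; split.
  by apply/measurable_EFinP/measurable_funTS; exact: measurable_g.
have := integral_exp_g a0 a1 (lexx 0); rewrite powR0 ?gt_eqF // addr0 invr1 => E.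
rewrite (_ : (\int[leb]_(x in _) _)%E = 1%E) ?ltry // -E.
apply: eq_integral => x; rewrite inE /= in_itv /= andbT => x0.
by rewrite mul0r oppr0 expR0 mulr1 gtr0_norm // g_gt0.
Qed.

(** * Tails of the integrated kernel *)

Lemma integrable_tail (R : realType) (K : R -> R) (x : R) :
  leb.-integrable [set: R] (EFin \o K) -> leb.-integrable `[x, +oo[ (EFin \o K).
Proof. by apply: integrableS => //; exact: measurable_itv. Qed.

Lemma calK_ge0 (R : realType) (K : R -> R) (x : R) : (forall y, 0 <= K y) -> 0 <= calK K x.
Proof. by move=> K0; apply: Rintegral_ge0 => y _. Qed.

Lemma calK_EFin (R : realType) (K : R -> R) (x : R) :
  leb.-integrable [set: R] (EFin \o K) ->
  (\int[leb]_(y in `[x, +oo[) (K y)%:E = (calK K x)%:E)%E.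
Proof.
move=> iK; rewrite /calK /Rintegral fineK //.
have iKx := integrable_tail x iK; exact: integrable_fin_num iKx.
Qed.

Lemma calK_nonincreasing (R : realType) (K : R -> R) :
  leb.-integrable [set: R] (EFin \o K) -> (forall y, 0 <= K y) ->
  nonincreasing_fun (calK K).
Proof.
move=> iK K0 x y xy; rewrite -lee_fin -!calK_EFin //.
apply: ge0_subset_integral => //=.
- by have /measurable_int := integrable_tail x iK.
- by move=> z _; rewrite lee_fin.
- by move=> z; rewrite /= !in_itv /= !andbT; exact: le_trans xy.
Qed.

Lemma measurable_calK (R : realType) (K : R -> R) :
  leb.-integrable [set: R] (EFin \o K) -> (forall y, 0 <= K y) ->
  measurable_fun setT (calK K).
Proof. by move=> iK K0; apply: nonincreasing_measurable => //; exact: calK_nonincreasing. Qed.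

(** If [K / h] tends to [C], then the tail integral of [K] is eventually between
    [(C - e) H] and [(C + e) H], where [H] is the tail integral of [h].  The
    weight [w] is proportional to [1 / H]. *)
Lemma calK_asymptotics (R : realType) (K h H w : R -> R) (a C L : R) :
  leb.-integrable [set: R] (EFin \o K) ->
  (forall x, a < x -> is_derive x 1 H (- h x)) ->
  (forall x, a < x -> 0 < h x) ->
  (forall x, a < x -> {for x, continuous h}) ->
  H x @[x --> +oo%R] --> (0 : R) ->
  (forall x, a < x -> 0 < H x) ->
  K x / h x @[x --> +oo%R] --> C ->
  (forall z, a < z -> w z = L / H z) ->
  w z * calK K z @[z --> +oo%R] --> L * C.
Proof.
move=> iK dH h0 ch H0 Hp Kh wE.
have main : calK K z / H z @[z --> +oo%R] --> C.
  apply/cvgrPdist_le => e e0.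
  have [M [Mr hM]] : \forall x \near +oo%R, `|C - K x / h x| <= e by move/cvgrPdist_le : Kh; apply.
  near=> z.
  have az : a < z by near: z; apply: nbhs_pinfty_gt; exact: num_real.
  have Mz : M < z by near: z; apply: nbhs_pinfty_gt; exact: num_real.
  have Hz := Hp z az.
  have T := integral_tail_primitive az dH (fun x ax => ltW (h0 x ax)) ch H0.
  have mh : measurable_fun `[z, +oo[ h.
    apply: (@measurable_funS _ _ _ _ `]a, +oo[) => //.
      by move=> x; rewrite /= !in_itv /= !andbT; exact: lt_le_trans.
    apply: open_continuous_measurable_fun; first exact: interval_open.
    by move=> x; rewrite inE /= in_itv /= andbT; exact: ch.
  have ih : leb.-integrable `[z, +oo[ (EFin \o h).
    apply/integrableP; split; first exact/measurable_EFinP.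
    rewrite (_ : (\int[leb]_(x in _) _)%E = (H z)%:E) ?ltry // -T.
    apply: eq_integral => x; rewrite inE /= in_itv /= andbT => zx.
    by rewrite gtr0_norm // h0 // (lt_le_trans az).
  have Hh : \int[leb]_(x in `[z, +oo[) h x = H z by rewrite /Rintegral T.
  have bnd x : z <= x -> (C - e) * h x <= K x <= (C + e) * h x.
    move=> zx; have hx : 0 < h x by rewrite h0 // (lt_le_trans az).
    have := hM x (lt_le_trans Mz zx); rewrite ler_distlC => /andP[u1 u2].
    by apply/andP; split; [rewrite -ler_pdivlMr|rewrite -ler_pdivrMr].
  have iKz := integrable_tail z iK.
  have iC (c : R) : leb.-integrable `[z, +oo[ (EFin \o (fun x => c * h x)).
    by have := @integrableZl _ _ R leb _ (measurable_itv `[z, +oo[) c _ ih.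
  have IC (c : R) : \int[leb]_(x in `[z, +oo[) (c * h x) = c * H z.
    by rewrite RintegralZl ?Hh.
  rewrite ler_distlC ler_pdivlMr // ler_pdivrMr // -!IC /calK; apply/andP; split.
    apply: le_Rintegral => // x; rewrite /= in_itv /= andbT => /bnd /andP[+ _] //.
  apply: le_Rintegral => // x; rewrite /= in_itv /= andbT => /bnd /andP[_ +] //.
have : L * (calK K z / H z) @[z --> +oo%R] --> L * C by apply: cvgM => //; exact: cvg_cst.
apply: cvg_trans; apply: near_eq_cvg; near=> z.
rewrite wE //; first by rewrite mulrCA mulrC mulrAC.
by near: z; apply: nbhs_pinfty_gt; exact: num_real.
Unshelve. all: by end_near. Qed.

(** * Limits of phi by dominated convergence *)

Lemma measurable_phi_integrand (R : realType) (K : R -> R) (al c z : R) : 0 < al ->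
  leb.-integrable [set: R] (EFin \o K) -> (forall y, 0 <= K y) ->
  measurable_fun setT (fun r => g al r * calK K (z + c * r)).
Proof.
move=> a0 iK K0; apply: measurable_funM; first exact: measurable_g.
apply: (measurableT_comp (measurable_calK iK K0)).
by apply: measurable_funD => //; exact: measurable_funM.
Qed.

Lemma phi_integrable (R : realType) (K : R -> R) (al c z : R) :
  0 < al -> al < 1 -> 0 <= c ->
  leb.-integrable [set: R] (EFin \o K) -> (forall y, 0 <= K y) ->
  leb.-integrable `]0%R, +oo[ (EFin \o (fun r => g al r * calK K (z + c * r))).
Proof.
move=> a0 a1 c0 iK K0; have ig := g_integrable a0 a1; have mpos := @measurable_pos R.
have iZ : leb.-integrable `]0%R, +oo[ (fun r : R => (calK K z)%:E * (g al r)%:E)%E.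
  exact: integrableZl.
apply: (le_integrable _ _ _ iZ) => //.
  by apply/measurable_EFinP/measurable_funTS; exact: measurable_phi_integrand.
move=> r; rewrite /= in_itv /= andbT => r0; have g0 := g_gt0 a0 a1 r0.
have p1 : 0 <= g al r * calK K (z + c * r) by rewrite mulr_ge0 ?calK_ge0 // ltW.
have p2 : 0 <= calK K z * g al r by rewrite mulr_ge0 ?calK_ge0 // ltW.
rewrite /= lee_fin (ger0_norm p1) (ger0_norm p2) mulrC.
apply: ler_wpM2r; [exact: ltW|apply: calK_nonincreasing => //].
by rewrite lerDl mulr_ge0 // ltW.
Qed.

(** As [calK K] is nonincreasing, its values at [z + c r] are at most its value
    at [z], so a multiple of [g] dominates the integrand. *)
Lemma phi_limit (R : realType) (K : R -> R) (al c : R) (w ell : R -> R) (B : R) :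
  0 < al -> al < 1 -> 0 <= c ->
  leb.-integrable [set: R] (EFin \o K) -> (forall y, 0 <= K y) ->
  (forall z, 0 <= w z) -> measurable_fun setT ell ->
  w z * calK K z @[z --> +oo%R] --> B ->
  (forall r, 0 < r -> w z * calK K (z + c * r) @[z --> +oo%R] --> ell r) ->
  w z * phi K al z c @[z --> +oo%R] --> \int[leb]_(r in `]0%R, +oo[) (g al r * ell r).
Proof.
move=> a0 a1 c0 iK K0 w0 mell wB wl.
have mcK := measurable_calK iK K0.
have mg := @measurable_g R al a0.
have ig := g_integrable a0 a1.
have mpos := @measurable_pos R.
have mf z := @measurable_phi_integrand _ K al c z a0 iK K0.
have cKle z r : 0 < r -> calK K (z + c * r) <= calK K z.
  by move=> r0; apply: calK_nonincreasing => //; rewrite lerDl mulr_ge0 // ltW.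
have phiE z : w z * phi K al z c =
    \int[leb]_(r in `]0%R, +oo[) (w z * (g al r * calK K (z + c * r))).
  by rewrite RintegralZl //; exact: phi_integrable.
under eq_cvg do rewrite phiE.
apply: (@Rintegral_dominated_cvg _ _ _ _ (fun r => (B + 1) * g al r)) => //.
- by move=> z; apply: measurable_funTS; apply: measurable_funM => //; exact: mf.
- by apply: measurable_funTS; apply: measurable_funM.
- move=> r; rewrite /= in_itv /= andbT => r0.
  under eq_cvg do rewrite mulrCA.
  by apply: cvgM; [exact: cvg_cst|exact: wl].
- exact: (@integrableZl _ _ R leb _ (@measurable_pos R) (B + 1) _ ig).
- near=> z => r; rewrite /= in_itv /= andbT => r0; have g0 := g_gt0 a0 a1 r0.
  have p1 : 0 <= w z * (g al r * calK K (z + c * r)).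
    by rewrite mulr_ge0 // mulr_ge0 ?calK_ge0 // ltW.
  rewrite (ger0_norm p1) mulrCA mulrC; apply: ler_wpM2r; first exact: ltW.
  apply: (@le_trans _ _ (w z * calK K z)); first by rewrite ler_wpM2l // cKle.
  near: z; have B1 : B < B + 1 by rewrite ltrDl.
  by have /cvgr_le := wB; apply.
Unshelve. all: by end_near. Qed.

Lemma cvgry_addr (R : realType) (d : R) : z + d @[z --> +oo%R] --> +oo%R.
Proof.
apply/cvgryPge => A; near=> z; rewrite -lerBlDr; near: z.
by apply: nbhs_pinfty_ge; exact: num_real.
Unshelve. all: by end_near. Qed.

Lemma cvg_ratio1 (R : realType) (d a : R) : 0 <= d ->
  (z / (z + d)) `^ a @[z --> +oo%R] --> (1 : R).
Proof.
move=> d0.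
have -> : (1 : R) = 1 `^ a by rewrite powR1.
apply: (@cvg_comp _ _ _ (fun z => z / (z + d)) (fun x => x `^ a) _ (nbhs (1 : R))); last first.
  exact: (continuous_powR (a := a) ltr01).
have h : 1 - d * (z + d)^-1 @[z --> +oo%R] --> (1 : R).
  rewrite -[X in _ --> X]subr0 -[X in _ --> _ - X](mulr0 d).
  apply: cvgB; first exact: cvg_cst.
  apply: cvgM; first exact: cvg_cst.
  apply/gtr0_cvgV0; last exact: cvgry_addr.
  by near=> z; rewrite ltr_wpDr //; near: z; apply: nbhs_pinfty_gt; exact: num_real.
apply: cvg_trans h; apply: near_eq_cvg; near=> z.
have z0 : 0 < z by near: z; apply: nbhs_pinfty_gt; exact: num_real.
by field; rewrite gt_eqF // ltr_wpDr.
Unshelve. all: by end_near. Qed.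

Lemma calK_tail_algebraic (R : realType) (K : R -> R) (beta C : R) :
  leb.-integrable [set: R] (EFin \o K) -> 1 < beta ->
  x `^ beta * K x @[x --> +oo%R] --> C ->
  z `^ (beta - 1) * calK K z @[z --> +oo%R] --> C / (beta - 1).
Proof.
move=> iK b1 cK; have b0 : 0 < beta - 1 by rewrite subr_gt0.
rewrite mulrC.
apply: (@calK_asymptotics _ _ (fun x => x `^ (- beta))
  (fun x => (beta - 1)^-1 * x `^ (1 - beta)) _ 0) => //.
- move=> x x0; have dp := is_derive1_powR (1 - beta) x0.
  have -> : - x `^ (- beta) = (beta - 1)^-1 *: ((1 - beta) * x `^ (1 - beta - 1)).
    rewrite /GRing.scale /= mulrA -[1 - beta]opprB mulrN mulVf ?gt_eqF // mulN1r.
    by congr (- (_ `^ _)); ring.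
  exact: is_deriveZ.
- by move=> x x0; rewrite powR_gt0.
- by move=> x x0; exact: continuous_powR.
- rewrite -(mulr0 (beta - 1)^-1); apply: cvgM; first exact: cvg_cst.
  by rewrite -opprB; exact: cvgr_powRN.
- by move=> x x0; rewrite mulr_gt0 ?invr_gt0 ?powR_gt0.
- apply: cvg_trans cK; apply: near_eq_cvg; near=> x.
  by rewrite powRN invrK mulrC.
- move=> z z0; rewrite -opprB powRN.
  by rewrite -[1 - beta]opprB powRN; field; rewrite !gt_eqF ?powR_gt0.
Unshelve. all: by end_near. Qed.

Lemma is_derive_expRN (R : realType) (f : R -> R) (x df : R) :
  is_derive x 1 f df ->
  is_derive x 1 (fun x => expR (- f x)) (- (expR (- f x) * df)).
Proof.
move=> hf; have hN : is_derive x 1 (fun x => - f x) (- df) by exact: is_deriveN.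
rewrite -mulrN.
exact: (@is_derive1_comp _ expR (fun x => - f x) x _ _ (is_derive_expR _) hN).
Qed.

Lemma cvg0_expRN (R : realType) (f : R -> R) :
  f x @[x --> +oo%R] --> +oo%R -> expR (- f x) @[x --> +oo%R] --> (0 : R).
Proof. by move=> h; apply: (cvg_comp f (fun x => expR (- x)) h); exact: cvgr_expR. Qed.

Lemma cvgry_scale (R : realType) (f : R -> R) (a : R) : 0 < a ->
  f x @[x --> +oo%R] --> +oo%R -> a * f x @[x --> +oo%R] --> +oo%R.
Proof.
move=> a0 /cvgryPge h; apply/cvgryPge => A; near=> x.
by rewrite -ler_pdivrMl //; near: x; exact: h.
Unshelve. all: by end_near. Qed.

Lemma calK_tail_exponential (R : realType) (K : R -> R) (nu C : R) :
  leb.-integrable [set: R] (EFin \o K) -> 0 < nu ->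
  expR (nu * x) * K x @[x --> +oo%R] --> C ->
  expR (nu * z) * calK K z @[z --> +oo%R] --> C / nu.
Proof.
move=> iK n0 cK; rewrite mulrC.
have dnu (x : R) : is_derive x 1 (fun x => nu * x) nu.
  by rewrite -[X in is_derive _ _ _ X]mulr1; exact: is_deriveZ.
apply: (@calK_asymptotics _ _ (fun x => expR (- (nu * x)))
  (fun x => nu^-1 * expR (- (nu * x))) _ 0) => //.
- move=> x x0; have dp := is_derive_expRN (dnu x).
  have -> : - expR (- (nu * x)) = nu^-1 *: (- (expR (- (nu * x)) * nu)).
    by rewrite /GRing.scale /=; field; rewrite gt_eqF.
  exact: is_deriveZ.
- by move=> x x0; exact: expR_gt0.
- move=> x x0; apply: differentiable_continuous; apply/derivable1_diffP.
  by case: (is_derive_expRN (dnu x)).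
- rewrite -(mulr0 nu^-1); apply: cvgM; first exact: cvg_cst.
  by apply: cvg0_expRN; apply: cvgry_scale => //; exact: cvg_id.
- by move=> x x0; rewrite mulr_gt0 ?invr_gt0 ?expR_gt0.
- apply: cvg_trans cK; apply: near_eq_cvg; near=> x.
  by rewrite expRN invrK mulrC.
- move=> z z0; rewrite expRN; field; rewrite !gt_eqF ?expR_gt0 //.
Unshelve. all: by end_near. Qed.

(** The comparison function [h] is minus the derivative of
    [x^(1-p) e^(- sigma x^p) / (sigma p)]; the factor by which it differs from
    [e^(- sigma x^p)] tends to [1]. *)
Lemma calK_tail_superexp (R : realType) (K : R -> R) (sigma p C : R) :
  leb.-integrable [set: R] (EFin \o K) -> 0 < sigma -> 1 < p ->
  expR (sigma * x `^ p) * K x @[x --> +oo%R] --> C ->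
  z `^ (p - 1) * expR (sigma * z `^ p) * calK K z @[z --> +oo%R] --> C / (sigma * p).
Proof.
move=> iK s0 p1 cK; rewrite mulrC.
have p0 : 0 < p by exact: lt_trans p1.
have sp0 : 0 < sigma * p by rewrite mulr_gt0.
pose E (x : R) := expR (- (sigma * x `^ p)).
have dE (x : R) : 0 < x -> is_derive x 1 E (- (E x * (sigma * (p * x `^ (p - 1))))).
  move=> x0; apply: is_derive_expRN; have dp := is_derive1_powR p x0.
  exact: is_deriveZ.
pose h (x : R) := E x * (1 + (p - 1) / (sigma * p) * x `^ (- p)).
pose H (x : R) := (sigma * p)^-1 * (x `^ (1 - p) * E x).
have q0 x : 0 < 1 + (p - 1) / (sigma * p) * x `^ (- p).
  by rewrite ltr_pwDl // mulr_ge0 ?powR_ge0 // divr_ge0 // ?subr_ge0 ltW.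
apply: (@calK_asymptotics _ _ h H _ 0) => //.
- move=> x x0; have dp := is_derive1_powR (1 - p) x0; have dEx := dE x x0.
  have -> : - h x = (sigma * p)^-1 *: (x `^ (1 - p) *: (- (E x * (sigma * (p * x `^ (p - 1))))) + E x *: ((1 - p) * x `^ (1 - p - 1))).
    rewrite /GRing.scale /= /h.
    have -> : 1 - p - 1 = - p by ring.
    have : x `^ (1 - p) * x `^ (p - 1) = 1.
      by rewrite -[1 - p]opprB powRN mulVf // gt_eqF // powR_gt0.
    move: (x `^ (1 - p)) (x `^ (p - 1)) (x `^ (- p)) (E x) => A B D e AB.
    transitivity (- e * (A * B) - e * ((p - 1) / (sigma * p) * D)); first by rewrite AB; ring.
    by field; rewrite !gt_eqF.
  by apply: is_deriveZ; exact: is_deriveM.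
- by move=> x x0; rewrite mulr_gt0 ?expR_gt0.
- move=> x x0; apply: cvgM.
    have : {for x, continuous E}; last by [].
    apply: differentiable_continuous; apply/derivable1_diffP.
    by case: (dE x x0).
  apply: cvgD; first exact: cvg_cst.
  by apply: cvgM; [exact: cvg_cst|exact: continuous_powR].
- rewrite -(mulr0 (sigma * p)^-1) -[X in _ * X](mulr0 0); apply: cvgM; first exact: cvg_cst.
  apply: cvgM.
    by rewrite -opprB; apply: cvgr_powRN; rewrite subr_gt0.
  by apply: cvg0_expRN; apply: cvgry_scale => //; exact: cvgry_powR.
- by move=> x x0; rewrite mulr_gt0 ?invr_gt0 ?mulr_gt0 ?expR_gt0 ?powR_gt0.
- have : (expR (sigma * x `^ p) * K x) / (1 + (p - 1) / (sigma * p) * x `^ (- p)) @[x --> +oo%R] --> C / (1 + (p - 1) / (sigma * p) * 0).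
    apply: cvgM => //; apply: cvgV; first by rewrite mulr0 addr0.
    apply: cvgD; first exact: cvg_cst.
    by apply: cvgM; [exact: cvg_cst|exact: cvgr_powRN].
  rewrite mulr0 addr0 divr1; apply: cvg_trans; apply: near_eq_cvg; near=> x.
  have F (e D k : R) : k / (e^-1 * D) = e * k / D by rewrite invfM invrK; ring.
  by rewrite /h /E expRN F.
- move=> z z0; rewrite /H /E expRN -[1 - p]opprB powRN.
  by field; rewrite !gt_eqF ?expR_gt0 ?powR_gt0.
Unshelve. all: by end_near. Qed.

(** The mean value theorem, the derivative of [x^p] being increasing. *)
Lemma powR_increment (R : realType) (p z d : R) : 1 < p -> 0 < z -> 0 <= d ->
  p * z `^ (p - 1) * d <= (z + d) `^ p - z `^ p <= p * (z + d) `^ (p - 1) * d.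
Proof.
move=> p1 z0; rewrite le_eqVlt => /orP[/eqP <-|d0].
  by rewrite addr0 subrr !mulr0 lexx.
have zzd : z < z + d by rewrite ltrDl.
have dp (x : R) : 0 < x -> is_derive x 1 (fun x => x `^ p) (p * x `^ (p - 1)).
  by move=> x0; exact: is_derive1_powR.
have [||x zx ->] := @MVT _ (fun x => x `^ p) (fun x => p * x `^ (p - 1)) z (z + d) zzd.
- by move=> x; rewrite in_itv /= => /andP[zx _]; apply: dp; exact: lt_trans zx.
- apply: continuous_in_subspaceT => x; rewrite inE /= in_itv /= => /andP[zx _].
  by apply: continuous_powR; exact: lt_le_trans zx.
have -> : z + d - z = d by ring.
move: zx; rewrite in_itv /= => /andP[zx xzd].
have p0 : 0 < p by exact: lt_trans p1.
rewrite !ler_pM2r // !ler_pM2l //; apply/andP; split; apply: ge0_ler_powR;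
  rewrite ?subr_ge0 ?nnegrE ?ltW //; lra.
Qed.

(** * The three decay regimes *)

(** The common form of the regimes where [g] is not rescaled: the limiting
    profile is an exponential in [r], possibly of rate [l = 0], and its integral
    against [g] is a Laplace transform. *)
Lemma phi_limit_exp (R : realType) (K : R -> R) (al c l : R) (w : R -> R) (M : R) :
  0 < al -> al < 1 -> 0 <= c -> 0 <= l ->
  leb.-integrable [set: R] (EFin \o K) -> (forall y, 0 <= K y) ->
  (forall z, 0 <= w z) ->
  w z * calK K z @[z --> +oo%R] --> M ->
  (forall r, 0 < r ->
    w z * calK K (z + c * r) @[z --> +oo%R] --> M * expR (- (l * r))) ->
  w z * phi K al z c @[z --> +oo%R] --> M / (1 + l `^ al).
Proof.
move=> a0 a1 c0 l0 iK K0 w0 wM wl.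
have mexp : measurable_fun setT (fun r : R => expR (- (l * r))).
  by apply/measurable_EFinP; exact: measurable_expZ.
have mell : measurable_fun setT (fun r : R => M * expR (- (l * r))).
  exact: measurable_funM.
have := @phi_limit R K al c w (fun r => M * expR (- (l * r))) M a0 a1 c0 iK K0 w0 mell wM wl.
have -> : \int[leb]_(r in `]0%R, +oo[) (g al r * (M * expR (- (l * r)))) = M / (1 + l `^ al).
  under eq_Rintegral do rewrite mulrCA.
  rewrite RintegralZl //.
    by rewrite /Rintegral integral_exp_g.
  have ig := g_integrable a0 a1.
  apply: (le_integrable _ _ _ ig) => //.
    apply/measurable_EFinP/measurable_funTS; apply: measurable_funM => //.
    exact: measurable_g.
  move=> r; rewrite /= in_itv /= andbT => r0; have g0 := g_gt0 a0 a1 r0.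
  rewrite lee_fin normrM ger0_norm ?(ltW g0) //.
  rewrite ger0_norm ?expR_ge0 // ler_piMr ?(ltW g0) //.
  by rewrite -expR0 ler_expR oppr_le0 mulr_ge0 // ltW.
by [].
Qed.

Lemma phi_tail_algebraic (R : realType) (K : R -> R) (al c beta C : R) :
  0 < al -> al < 1 -> 0 <= c ->
  leb.-integrable [set: R] (EFin \o K) -> (forall y, 0 <= K y) ->
  1 < beta -> x `^ beta * K x @[x --> +oo%R] --> C ->
  z `^ (beta - 1) * phi K al z c @[z --> +oo%R] --> C / (beta - 1).
Proof.
move=> a0 a1 c0 iK K0 b1 cK; have T := calK_tail_algebraic iK b1 cK.
have -> : C / (beta - 1) = C / (beta - 1) / (1 + 0 `^ al).
  by rewrite powR0 ?gt_eqF // addr0 divr1.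
apply: phi_limit_exp => // [z|r r0]; first exact: powR_ge0.
have cr : 0 <= c * r by rewrite mulr_ge0 // ltW.
rewrite mul0r oppr0 expR0 mulr1 -[X in _ --> X]mul1r.
have T' : (z + c * r) `^ (beta - 1) * calK K (z + c * r) @[z --> +oo%R] --> C / (beta - 1).
  exact: (cvg_comp _ _ (@cvgry_addr R (c * r)) T).
have T2 : (z / (z + c * r)) `^ (beta - 1) * ((z + c * r) `^ (beta - 1) * calK K (z + c * r))
    @[z --> +oo%R] --> 1 * (C / (beta - 1)).
  by apply: cvgM => //; exact: cvg_ratio1.
apply: cvg_trans T2; apply: near_eq_cvg; near=> z.
have z0 : 0 < z by near: z; apply: nbhs_pinfty_gt; exact: num_real.
have Z0 : 0 < z + c * r by rewrite ltr_wpDr.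
rewrite mulrA -powRM ?(ltW Z0) ?divr_ge0 ?(ltW z0) ?(ltW Z0) //.
by rewrite divfK // gt_eqF.
Unshelve. all: by end_near. Qed.

Lemma phi_tail_exponential (R : realType) (K : R -> R) (al c nu C : R) :
  0 < al -> al < 1 -> 0 <= c ->
  leb.-integrable [set: R] (EFin \o K) -> (forall y, 0 <= K y) ->
  0 < nu -> expR (nu * x) * K x @[x --> +oo%R] --> C ->
  expR (nu * z) * phi K al z c @[z --> +oo%R] --> C / (nu * (1 + (nu * c) `^ al)).
Proof.
move=> a0 a1 c0 iK K0 n0 cK; have T := calK_tail_exponential iK n0 cK.
rewrite invfM mulrA.
apply: phi_limit_exp => // [|r r0]; first by rewrite mulr_ge0 // ltW.
have T' : expR (nu * (z + c * r)) * calK K (z + c * r) @[z --> +oo%R] --> C / nu.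
  exact: (cvg_comp _ _ (@cvgry_addr R (c * r)) T).
have T2 : expR (nu * (z + c * r)) * calK K (z + c * r) * expR (- (nu * c * r))
    @[z --> +oo%R] --> C / nu * expR (- (nu * c * r)).
  by apply: cvgM => //; exact: cvg_cst.
apply: cvg_trans T2; apply: near_eq_cvg; near=> z.
by rewrite mulrAC -expRD; congr (expR _ * _); ring.
Unshelve. all: by end_near. Qed.

(** With [c = 0] the integrand is [g] times a constant, and the mass of [g] is
    [1]. *)
Lemma phi_tail_superexp_c0 (R : realType) (K : R -> R) (al sigma p C : R) :
  0 < al -> al < 1 ->
  leb.-integrable [set: R] (EFin \o K) -> (forall y, 0 <= K y) ->
  0 < sigma -> 1 < p -> expR (sigma * x `^ p) * K x @[x --> +oo%R] --> C ->
  z `^ (p - 1) * expR (sigma * z `^ p) * phi K al z 0 @[z --> +oo%R] --> C / (sigma * p).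
Proof.
move=> a0 a1 iK K0 s0 p1 cK; have T := calK_tail_superexp iK s0 p1 cK.
have -> : C / (sigma * p) = C / (sigma * p) / (1 + 0 `^ al).
  by rewrite powR0 ?gt_eqF // addr0 divr1.
apply: (@phi_limit_exp _ _ _ _ _ (fun z => z `^ (p - 1) * expR (sigma * z `^ p))) => // [z|r r0].
  by rewrite mulr_ge0 ?powR_ge0 ?expR_ge0.
rewrite mul0r oppr0 expR0 mulr1.
by under eq_cvg do rewrite addr0.
Qed.

Lemma phi_rescale (R : realType) (K : R -> R) (al c z a : R) :
  0 < al -> al < 1 -> 0 <= c ->
  leb.-integrable [set: R] (EFin \o K) -> (forall y, 0 <= K y) -> 0 < a ->
  (\int[leb]_(s in `]0%R, +oo[) (a * (g al (a * s) * calK K (z + c * (a * s))))%:E =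
  (phi K al z c)%:E)%E.
Proof.
move=> a0 a1 c0 iK K0 ap; have iF := @phi_integrable _ K al c z a0 a1 c0 iK K0.
have Ffin : (\int[leb]_(s in `]0%R, +oo[) (g al s * calK K (z + c * s))%:E)%E \is a fin_num.
  exact: integrable_fin_num iF.
rewrite /phi /Rintegral fineK //.
have Fp (x : R) : 0 < x -> (0 <= (g al x * calK K (z + c * x))%:E)%E.
  by move=> x0; rewrite lee_fin mulr_ge0 ?calK_ge0 // ltW // g_gt0.
have mF := @measurable_phi_integrand _ K al c z a0 iK K0.
rewrite (integral_pos_scale ap (F := fun x => (g al x * calK K (z + c * x))%:E)) //; last exact/measurable_EFinP.
rewrite -ge0_integralZl //=.
- apply: (measurable_funS measurableT) => //.
  apply/measurable_EFinP; apply: (measurableT_comp mF); exact: measurable_funM.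
- by move=> x; rewrite /= in_itv /= andbT => x0; apply: Fp; exact: mulr_gt0.
- by rewrite lee_fin ltW.
Qed.

Lemma phi_rescale_integrable (R : realType) (K : R -> R) (al c z a : R) :
  0 < al -> al < 1 -> 0 <= c ->
  leb.-integrable [set: R] (EFin \o K) -> (forall y, 0 <= K y) -> 0 < a ->
  leb.-integrable `]0%R, +oo[
    (EFin \o (fun s => a * (g al (a * s) * calK K (z + c * (a * s))))).
Proof.
move=> a0 a1 c0 iK K0 ap; have mF := @measurable_phi_integrand _ K al c z a0 iK K0.
apply/integrableP; split.
  apply/measurable_EFinP/measurable_funTS; apply: measurable_funM => //.
  by apply: (measurableT_comp mF); exact: measurable_funM.
rewrite (_ : (\int[leb]_(x in _) _)%E = (phi K al z c)%:E) ?ltry //.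
rewrite -(phi_rescale z a0 a1 c0 iK K0 ap); apply: eq_integral => s.
rewrite inE /= in_itv /= andbT => s0.
rewrite /= ger0_norm //; apply: mulr_ge0; first exact: ltW.
by apply: mulr_ge0; [rewrite ltW // g_gt0 // mulr_gt0|exact: calK_ge0].
Qed.

Lemma g_rescale (R : realType) (al a s : R) : 0 < a -> 0 < s ->
  a `^ (1 - al) * g al (a * s) = s `^ (al - 1) * ml_diag al (- (a * s) `^ al).
Proof.
move=> a0 s0; rewrite gE powRM ?ltW // -[1 - al]opprB powRN.
by rewrite mulrA mulrA mulVf ?mul1r // gt_eqF // powR_gt0.
Qed.

Lemma integral_rlker_exp (R : realType) (al l : R) : 0 < al -> 0 < l ->
  (\int[leb]_(s in `]0%R, +oo[) (rlker al s * expR (- (l * s)))%:E = (l `^ (- al))%:E)%E.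
Proof.
move=> a0 l0; rewrite -laplace_rlker // /laplace [RHS]integral_vanish_neg; last first.
  by move=> t t0; rewrite /= rlker_le0 // mule0.
by apply: eq_integral => s _; rewrite /= -EFinM mulrC.
Qed.

(** The scale [a z = z^(1-p)] is chosen so that
    [(z + c a s)^p - z^p] tends to [p c s].  The rescaled integrand [f z s]
    factors ([fE]) into a rescaled [g], tending to [rlker al s], a power of
    [z / (z + c a s)], tending to [1], an exponential, and the normalised tail
    of [calK K], tending to [L].  The first three are at most their limits, the
    last is eventually at most [L + 1]. *)
Lemma phi_tail_superexp (R : realType) (K : R -> R) (al c sigma p C : R) :
  0 < al -> al < 1 -> 0 < c ->
  leb.-integrable [set: R] (EFin \o K) -> (forall y, 0 <= K y) ->
  0 < sigma -> 1 < p -> expR (sigma * x `^ p) * K x @[x --> +oo%R] --> C ->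
  z `^ ((1 + al) * (p - 1)) * expR (sigma * z `^ p) * phi K al z c @[z --> +oo%R]
    --> C / ((sigma * p) `^ (1 + al) * c `^ al).
Proof.
move=> a0 a1 c0 iK K0 s0 p1 cK; have T := calK_tail_superexp iK s0 p1 cK.
pose L := C / (sigma * p); rewrite -/L in T.
pose v z := z `^ (p - 1) * expR (sigma * z `^ p) * calK K z.
pose a (z : R) := z `^ (1 - p).
pose w (z : R) := z `^ ((1 + al) * (p - 1)) * expR (sigma * z `^ p).
pose f z s := w z * (a z * (g al (a z * s) * calK K (z + c * (a z * s)))).
have sp0 : 0 < sigma * p by rewrite mulr_gt0 // (lt_trans ltr01).
have spc0 : 0 < sigma * p * c by rewrite mulr_gt0.
have p10 : 0 < p - 1 by rewrite subr_gt0.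
have fE z s : 0 < z -> 0 < s -> f z s =
    (a z `^ (1 - al) * g al (a z * s)) *
    ((z / (z + c * (a z * s))) `^ (p - 1) *
     expR (- (sigma * ((z + c * (a z * s)) `^ p - z `^ p))) * v (z + c * (a z * s))).
  move=> z0 s1.
  have az0 : 0 < a z by rewrite powR_gt0.
  have d0 : 0 <= c * (a z * s) by rewrite !mulr_ge0 // ltW.
  rewrite /f /w /v; set Z := z + c * (a z * s).
  have Z0 : 0 < Z by rewrite ltr_wpDr.
  have E1 : (z / Z) `^ (p - 1) * Z `^ (p - 1) = z `^ (p - 1).
    by rewrite -powRM ?divr_ge0 ?(ltW z0) ?(ltW Z0) // divfK // gt_eqF.
  have E2 : expR (- (sigma * (Z `^ p - z `^ p))) * expR (sigma * Z `^ p) = expR (sigma * z `^ p).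
    by rewrite -expRD; congr expR; ring.
  have E3 : z `^ ((1 + al) * (p - 1)) * a z = a z `^ (1 - al) * z `^ (p - 1).
    rewrite /a -powRrM -!powRD ?(gt_eqF z0) ?implybT //.
    by congr (_ `^ _); ring.
  move: E1 E2 E3.
  move: ((z / Z) `^ (p - 1)) (Z `^ (p - 1)) (z `^ (p - 1)) => A1 A2 A3.
  move: (expR (- _)) (expR (sigma * Z `^ p)) (expR (sigma * z `^ p)) => B1 B2 B3.
  move: (z `^ _) (a z `^ _) (g al _) (calK K Z) => D1 D2 G k E1 E2 E3.
  transitivity ((D1 * a z) * B3 * G * k); first by ring.
  by rewrite E3 -E1 -E2; ring.
have azp z : 0 < z -> 0 < a z by move=> z0; rewrite powR_gt0.
have a_cvg0 : a z @[z --> +oo%R] --> (0 : R).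
  by rewrite /a -opprB; exact: cvgr_powRN.
have za z : 0 < z -> z `^ (p - 1) * a z = 1.
  by move=> z0; rewrite /a -[1 - p]opprB powRN divff // gt_eqF // powR_gt0.
have p0 : 0 < p by exact: lt_trans p1.
have lim1 s : 0 < s -> a z `^ (1 - al) * g al (a z * s) @[z --> +oo%R] --> rlker al s.
  move=> s1.
  have h : s `^ (al - 1) * ml_diag al (- (z `^ (- ((p - 1) * al)) * s `^ al)) @[z --> +oo%R]
      --> s `^ (al - 1) * ml_diag al (- (0 * s `^ al)).
    apply: cvgM; first exact: cvg_cst.
    apply: (@cvg_comp _ _ _ (fun z => - (z `^ (- ((p - 1) * al)) * s `^ al)) (ml_diag al) _
      (nbhs (- (0 * s `^ al)))); last exact: continuous_ml_diag.
    apply: cvgN; apply: cvgM; last exact: cvg_cst.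
    by apply: cvgr_powRN; rewrite mulr_gt0.
  have -> : rlker al s = s `^ (al - 1) * ml_diag al (- (0 * s `^ al)).
    by rewrite mul0r oppr0 ml_diag0 /rlker s1.
  apply: cvg_trans h; apply: near_eq_cvg; near=> z.
  have z0 : 0 < z by near: z; apply: nbhs_pinfty_gt; exact: num_real.
  rewrite (g_rescale al (azp _ z0) s1) (powRM _ (ltW (azp _ z0)) (ltW s1)) /a -powRrM.
  by have -> : (1 - p) * al = - ((p - 1) * al) by ring.
have lim_rho s : 0 < s -> 1 + c * s * z `^ (- p) @[z --> +oo%R] --> (1 : R).
  move=> s1; rewrite -[X in _ --> X]addr0 -[X in _ --> _ + X](mulr0 (c * s)).
  apply: cvgD; first exact: cvg_cst.
  by apply: cvgM; [exact: cvg_cst|exact: cvgr_powRN].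
have rhoE z s : 0 < z -> 0 < s -> z + c * (a z * s) = z * (1 + c * s * z `^ (- p)).
  move=> z0 s1; have -> : a z = z * z `^ (- p).
    rewrite /a -[X in X * _](powRr1 (ltW z0)) -powRD ?(gt_eqF z0) ?implybT //.
  by ring.
have rho_gt0 z s : 0 < s -> 0 < 1 + c * s * z `^ (- p).
  by move=> s1; rewrite ltr_pwDl // !mulr_ge0 ?powR_ge0 // ltW.
have lim2 s : 0 < s -> (z / (z + c * (a z * s))) `^ (p - 1) @[z --> +oo%R] --> (1 : R).
  move=> s1.
  have h : ((1 + c * s * z `^ (- p))^-1) `^ (p - 1) @[z --> +oo%R] --> (1^-1 : R) `^ (p - 1).
    apply: (@cvg_comp _ _ _ (fun z => (1 + c * s * z `^ (- p))^-1) (fun x => x `^ (p - 1)) _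
      (nbhs (1^-1 : R))); last first.
      by apply: continuous_powR; rewrite invr1.
    by apply: cvgV => //; exact: lim_rho.
  rewrite invr1 powR1 in h.
  apply: cvg_trans h; apply: near_eq_cvg; near=> z.
  have z0 : 0 < z by near: z; apply: nbhs_pinfty_gt; exact: num_real.
  by rewrite rhoE // invfM mulrA divff ?mul1r // gt_eqF.
have incr z s : 0 < z -> 0 < s ->
    p * c * s <= (z + c * (a z * s)) `^ p - z `^ p
      <= p * c * s * (1 + c * s * z `^ (- p)) `^ (p - 1).
  move=> z0 s1; have d0 : 0 <= c * (a z * s) by rewrite !mulr_ge0 // ltW // azp.
  have := powR_increment p1 z0 d0.
  have -> : (z + c * (a z * s)) `^ (p - 1) = z `^ (p - 1) * (1 + c * s * z `^ (- p)) `^ (p - 1).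
    by rewrite (rhoE z s z0 s1) (powRM _ (ltW z0) (ltW (rho_gt0 z s s1))).
  have -> : p * z `^ (p - 1) * (c * (a z * s)) = p * c * s * (z `^ (p - 1) * a z) by ring.
  have -> : p * (z `^ (p - 1) * (1 + c * s * z `^ (- p)) `^ (p - 1)) * (c * (a z * s)) =
    p * c * s * (1 + c * s * z `^ (- p)) `^ (p - 1) * (z `^ (p - 1) * a z) by ring.
  by rewrite za // !mulr1.
have lim3 s : 0 < s -> expR (- (sigma * ((z + c * (a z * s)) `^ p - z `^ p)))
    @[z --> +oo%R] --> expR (- (sigma * (p * c * s))).
  move=> s1.
  apply: (@cvg_comp _ _ _ (fun z => - (sigma * ((z + c * (a z * s)) `^ p - z `^ p))) expR _
    (nbhs (- (sigma * (p * c * s))))); last exact: continuous_expR.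
  apply: cvgN; apply: cvgM; first exact: cvg_cst.
  apply: (@squeeze_cvgr _ _ _ _ (fun=> p * c * s)
    (fun z => p * c * s * (1 + c * s * z `^ (- p)) `^ (p - 1))).
  - near=> z.
    have z0 : 0 < z by near: z; apply: nbhs_pinfty_gt; exact: num_real.
    exact: incr.
  - exact: cvg_cst.
  - have h : (1 + c * s * z `^ (- p)) `^ (p - 1) @[z --> +oo%R] --> (1 : R) `^ (p - 1).
      apply: (@cvg_comp _ _ _ (fun z => 1 + c * s * z `^ (- p)) (fun x => x `^ (p - 1)) _
        (nbhs (1 : R))); first exact: lim_rho.
      exact: continuous_powR.
    rewrite powR1 in h; rewrite -[X in _ --> X]mulr1.
    by apply: cvgM; first exact: cvg_cst.
have Zoo s : 0 < s -> z + c * (a z * s) @[z --> +oo%R] --> +oo%R.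
  move=> s1; apply/cvgryPge => A; near=> z.
  have z0 : 0 < z by near: z; apply: nbhs_pinfty_gt; exact: num_real.
  apply: (@le_trans _ _ z); last by rewrite lerDl !mulr_ge0 // ltW // azp.
  by near: z; apply: nbhs_pinfty_ge; exact: num_real.
have lim4 s : 0 < s -> v (z + c * (a z * s)) @[z --> +oo%R] --> L.
  by move=> s1; exact: (cvg_comp _ v (Zoo s s1) T).
have limf s : 0 < s -> f z s @[z --> +oo%R] -->
    rlker al s * (L * expR (- (sigma * p * c * s))).
  move=> s1.
  have h : (a z `^ (1 - al) * g al (a z * s)) *
    ((z / (z + c * (a z * s))) `^ (p - 1) *
     expR (- (sigma * ((z + c * (a z * s)) `^ p - z `^ p))) * v (z + c * (a z * s)))
    @[z --> +oo%R] --> rlker al s * (1 * expR (- (sigma * (p * c * s))) * L).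
    apply: cvgM; first exact: lim1.
    apply: cvgM; last exact: lim4.
    by apply: cvgM; [exact: lim2|exact: lim3].
  have -> : L * expR (- (sigma * p * c * s)) = 1 * expR (- (sigma * (p * c * s))) * L.
    by rewrite mul1r mulrC; congr (expR _ * _); ring.
  apply: cvg_trans h; apply: near_eq_cvg; near=> z.
  have z0 : 0 < z by near: z; apply: nbhs_pinfty_gt; exact: num_real.
  by rewrite fE.
have L1 : L < L + 1 by rewrite ltrDl.
have [M [_ hM]] : \forall Z \near +oo%R, v Z <= L + 1 by have /cvgr_le/(_ _ L1) := T.
have L10 : 0 <= L + 1.
  apply: (@le_trans _ _ (v (M + 1))); last by apply: hM; rewrite ltrDl.
  by rewrite /v !mulr_ge0 ?powR_ge0 ?expR_ge0 ?calK_ge0.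
have f_ge0 z s : 0 < z -> 0 < s -> 0 <= f z s.
  move=> z0 s1; apply: mulr_ge0; first by rewrite mulr_ge0 ?powR_ge0 ?expR_ge0.
  apply: mulr_ge0; first by rewrite ltW // azp.
  apply: mulr_ge0; last exact: calK_ge0.
  by rewrite ltW // g_gt0 // mulr_gt0 ?azp.
have dom z s : M < z -> 0 < z -> 0 < s ->
    `|f z s| <= (L + 1) * (rlker al s * expR (- (sigma * p * c * s))).
  move=> Mz z0 s1; rewrite (ger0_norm (f_ge0 z s z0 s1)) fE //.
  have d0 : 0 <= c * (a z * s) by rewrite !mulr_ge0 // ltW // azp.
  have Z0 : 0 < z + c * (a z * s) by rewrite ltr_wpDr.
  have -> : (L + 1) * (rlker al s * expR (- (sigma * p * c * s))) =
     rlker al s * (1 * expR (- (sigma * p * c * s)) * (L + 1)) by ring.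
  have b1 : a z `^ (1 - al) * g al (a z * s) <= rlker al s.
    have as0 : 0 < a z * s by rewrite mulr_gt0 ?azp.
    have gle : g al (a z * s) <= rlker al (a z * s).
      by rewrite -gplusE //; exact: gplus_le_rlker.
    apply: (le_trans (ler_wpM2l (powR_ge0 _ _) gle)).
    rewrite rlkerZ ?azp // mulrA -powRD ?(gt_eqF (azp z z0)) ?implybT //.
    have -> : 1 - al + (al - 1) = 0 by ring.
    by rewrite powRr0 mul1r.
  have b2 : (z / (z + c * (a z * s))) `^ (p - 1) <= 1.
    apply: (@le_trans _ _ (1 `^ (p - 1))); last by rewrite powR1.
    apply: (ge0_ler_powR (ltW p10)); rewrite ?nnegrE ?divr_ge0 ?(ltW z0) ?(ltW Z0) //.
    by rewrite ler_pdivrMr // mul1r lerDl.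
  have b3 : expR (- (sigma * ((z + c * (a z * s)) `^ p - z `^ p))) <=
      expR (- (sigma * p * c * s)).
    have /andP[i1 _] := incr z s z0 s1.
    rewrite ler_expR lerN2 -!mulrA ler_pM2l //; move: i1; rewrite -!mulrA; exact: id.
  have b4 : v (z + c * (a z * s)) <= L + 1.
    by apply: hM; apply: (lt_le_trans Mz); rewrite lerDl.
  have v0 : 0 <= v (z + c * (a z * s)).
    by rewrite /v !mulr_ge0 ?powR_ge0 ?expR_ge0 ?calK_ge0.
  have g0 : 0 <= g al (a z * s) by rewrite ltW // g_gt0 // mulr_gt0 ?azp.
  apply: ler_pM; [exact: mulr_ge0 (powR_ge0 _ _) g0| |exact: b1|].
    by rewrite mulr_ge0 // mulr_ge0 ?powR_ge0 ?expR_ge0.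
  apply: ler_pM; [by rewrite mulr_ge0 ?powR_ge0 ?expR_ge0|exact: v0| |exact: b4].
  by apply: ler_pM; [exact: powR_ge0|exact: expR_ge0|exact: b2|exact: b3].
have mfe : measurable_fun setT (fun s : R => rlker al s * expR (- (sigma * p * c * s))).
  apply: measurable_funM; first exact: measurable_rlker.
  by apply/measurable_EFinP; exact: measurable_expZ.
have ife : leb.-integrable `]0%R, +oo[
    (EFin \o (fun s => rlker al s * expR (- (sigma * p * c * s)))).
  apply/integrableP; split; first by apply/measurable_EFinP; exact: measurable_funTS.
  rewrite (_ : (\int[leb]_(x in _) _)%E = ((sigma * p * c) `^ (- al))%:E) ?ltry //.
  rewrite -integral_rlker_exp //; apply: eq_integral => s _ /=.
  by rewrite ger0_norm // mulr_ge0 ?expR_ge0 // rlker_ge0.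
have int_l : \int[leb]_(s in `]0%R, +oo[) (rlker al s * (L * expR (- (sigma * p * c * s)))) =
    C / ((sigma * p) `^ (1 + al) * c `^ al).
  under eq_Rintegral do rewrite mulrCA.
  rewrite RintegralZl // /Rintegral integral_rlker_exp //= /L.
  have -> : (sigma * p) `^ (1 + al) = sigma * p * (sigma * p) `^ al.
    by rewrite powRD ?(gt_eqF sp0) ?implybT // powRr1 // ltW.
  rewrite powRN powRM ?(ltW sp0) ?(ltW c0) //.
  by field; rewrite !gt_eqF ?powR_gt0 // (lt_trans ltr01).
rewrite -int_l.
have cv : \int[leb]_(s in `]0%R, +oo[) f z s @[z --> +oo%R] -->
    \int[leb]_(s in `]0%R, +oo[) (rlker al s * (L * expR (- (sigma * p * c * s)))).
  apply: (@Rintegral_dominated_cvg _ _ _ _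
    (fun s => (L + 1) * (rlker al s * expR (- (sigma * p * c * s))))) => //.
  - move=> z; apply: measurable_funTS; rewrite /f.
    apply: measurable_funM => //; apply: measurable_funM => //.
    have mF := @measurable_phi_integrand _ K al c z a0 iK K0.
    by apply: (measurableT_comp mF); exact: measurable_funM.
  - apply: measurable_funTS; apply: measurable_funM; first exact: measurable_rlker.
    apply: measurable_funM => //.
    by apply/measurable_EFinP; exact: measurable_expZ.
  - by move=> s; rewrite /= in_itv /= andbT; exact: limf.
  - exact: (@integrableZl _ _ R leb _ (@measurable_pos R) (L + 1) _ ife).
  - near=> z => s; rewrite /= in_itv /= andbT; apply: dom.
      by near: z; apply: nbhs_pinfty_gt; exact: num_real.
    by near: z; apply: nbhs_pinfty_gt; exact: num_real.
apply: cvg_trans cv; apply: near_eq_cvg; near=> z.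
have z0 : 0 < z by near: z; apply: nbhs_pinfty_gt; exact: num_real.
have E := phi_rescale z a0 a1 (ltW c0) iK K0 (azp z z0).
have iE := @phi_rescale_integrable _ K al c z (a z) a0 a1 (ltW c0) iK K0 (azp z z0).
by rewrite /f RintegralZl // /Rintegral E.
Unshelve. all: by end_near. Qed.

Theorem proposition6p1 (R : realType) (alpha c : R) (K : R -> R)
    (alpha_gt0 : 0 < alpha) (alpha_lt1 : alpha < 1) (c_ge0 : 0 <= c)
    (K_L1 : lebesgue_measure.-integrable [set: R] (EFin \o K))
    (K_bounded : bounded_fun K)
    (K_continuous : continuous K)
    (K_ge0 : forall x : R, 0 <= K x)
    (K0_gt0 : 0 < K 0)
    (K_even : forall x : R, K x = K (- x)) :
  [/\ (forall beta Calg : R, 1 < beta -> 0 <= Calg ->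
        x `^ beta * K x @[x --> +oo%R] --> Calg ->
        z `^ (beta - 1) * phi K alpha z c @[z --> +oo%R]
          --> Calg / (beta - 1)),
      (forall nu Cexp : R, 0 < nu -> 0 <= Cexp ->
        expR (nu * x) * K x @[x --> +oo%R] --> Cexp ->
        expR (nu * z) * phi K alpha z c @[z --> +oo%R]
          --> Cexp / (nu * (1 + (nu * c) `^ alpha)))
    & (forall sigma p Csup : R, 0 < sigma -> 1 < p -> 0 < Csup ->
        expR (sigma * x `^ p) * K x @[x --> +oo%R] --> Csup ->
        (c = 0 ->
          z `^ (p - 1) * expR (sigma * z `^ p) * phi K alpha z 0
            @[z --> +oo%R] --> Csup / (sigma * p)) /\
        (0 < c ->
          z `^ ((1 + alpha) * (p - 1)) * expR (sigma * z `^ p)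
            * phi K alpha z c @[z --> +oo%R]
            --> Csup / ((sigma * p) `^ (1 + alpha) * c `^ alpha)))].
Proof.
split.
- move=> beta Calg b1 _ cK; exact: phi_tail_algebraic.
- move=> nu Cexp n0 _ cK; exact: phi_tail_exponential.
- move=> sigma p Csup s0 p1 _ cK; split=> [_|c0].
    exact: phi_tail_superexp_c0.
  exact: phi_tail_superexp.
Qed.
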